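(* Let $X$ be an operator space and let $u \in \mathrm{Ball}(X)$. Then $(X,u)$ is a unital operator space (or equivalently, $u$ is a unitary in $X$) if and only if for all $n \in \mathbb{N}$ and all $x \in M_n(X)$, $$\max\{ \Vert u_n + i^k x \Vert : k = 0,1,2,3\} \geq \sqrt{1 + \Vert x \Vert_n}.$$
   Context: All vector spaces are over $\mathbb{C}$ and operator spaces are complete. An operator space $X$ carries its matrix norms $\Vert\cdot\Vert_n$ on $M_n(X)$, the $n\times n$ matrices over $X$. $\mathrm{Ball}(X)$ is the closed unit ball $\{x \in X : \Vert x\Vert \le 1\}$. For $u \in X$, $u_n = u \otimes I_n \in M_n(X)$ is the diagonal matrix with $u$ in each diagonal entry. A pair $(X,u)$, with $X$ an operator space and $u \in X$, is a unital operator space if there exist a Hilbert space $H$ and a linear complete isometry $T : X \to B(H)$ with $T(u) = I_H$; in this case one also says that $u$ is a unitary in $X$. *)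

(* Defs.v *)
From HB Require Import structures.
From mathcomp Require Import all_boot all_order all_algebra.
From mathcomp Require Import sesquilinear complex.
From mathcomp Require Import all_classical all_reals all_analysis.

Set Implicit Arguments.
Unset Strict Implicit.
Unset Printing Implicit Defensive.

Import Order.TTheory GRing.Theory Num.Theory.
Import numFieldNormedType.Exports.

Local Open Scope classical_set_scope.
Local Open Scope ring_scope.

Record hilbertType (R : realType) := HilbertType {
  hilbert_sort :> completeNormedModType R[i];
  hdot : {dot hilbert_sort for Num.conj};
  hdotE : forall v : hilbert_sort, `|v| ^+ 2 = hdot v v
}.

Section OperatorNorms.
Variables (R : realType) (H : hilbertType R).

Definition bounded_operators : set (H -> H) :=
  [set f | linear f /\ continuous f].

(* The norm of a normed module over R[i] takes values in R[i]; it is a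
   nonnegative real there, so its real part loses nothing. *)
Definition l2norm n (v : 'I_n -> H) : R :=
  Num.sqrt (\sum_(i < n) complex.Re `|v i| ^+ 2).

(* M_n(B(H)) is identified with B(H^n). *)
Definition mxapply n (A : 'M[H -> H]_n) (v : 'I_n -> H) : 'I_n -> H :=
  fun i => \sum_(j < n) A i j (v j).

Definition opnorm n (A : 'M[H -> H]_n) : R :=
  sup [set l2norm (mxapply A v) | v in [set v | l2norm v <= 1]].

(* The pointwise vector space structure on H -> H restricts to the one of
   B(H). *)
Definition complete_isometry (X : lmodType R[i])
    (mxnorm : forall n, 'M[X]_n -> R) (T : {linear X -> (H -> H)}) : Prop :=
  (forall x : X, bounded_operators (T x)) /\
  (forall n (x : 'M[X]_n), (0 < n)%N -> opnorm (map_mx T x) = mxnorm n x).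

End OperatorNorms.

(* Operator spaces in the sense of Blecher and Le Merdy: a space with norms on
   the M_n(X), n >= 1, admitting a linear complete isometry into some B(H).
   The value of mxnorm 0 is irrelevant. *)
Record operatorSpace (R : realType) := OperatorSpace {
  opspace_sort :> completeNormedModType R[i];
  mxnorm : forall n, 'M[opspace_sort]_n -> R;
  mxnorm1 : forall x : opspace_sort,
    `|x| = (mxnorm (const_mx x : 'M[opspace_sort]_1))%:C%C;
  opspace_repr : exists (H : hilbertType R)
    (T : {linear opspace_sort -> (H -> H)}), complete_isometry mxnorm T
}.

Definition diag_amp (R : realType) (X : operatorSpace R) (u : X) n : 'M[X]_n :=
  \matrix_(i, j) (u *+ (i == j)).

Definition scale_entries (R : realType) (X : operatorSpace R) n
    (c : R[i]) (x : 'M[X]_n) : 'M[X]_n :=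
  map_mx (fun y : X => c *: y) x.

(* H is required to be nonzero: on the zero Hilbert space the identity is 0,
   so that the zero space would be unital with u = 0, contrary to the usual
   convention that a unitary has norm 1. *)
Definition unital_operator_space (R : realType) (X : operatorSpace R) (u : X)
    : Prop :=
  exists (H : hilbertType R) (T : {linear X -> (H -> H)}),
    [/\ exists v : H, v != 0, complete_isometry (@mxnorm R X) T & T u = id].

(* Main.v *)
Require Import Defs.
From HB Require Import structures.
From mathcomp Require Import all_boot all_order all_algebra.
From mathcomp Require Import sesquilinear complex.
From mathcomp Require Import all_classical all_reals all_analysis.
From mathcomp Require Import finmap ring lra.

Import Order.TTheory GRing.Theory Num.Theory.
Import numFieldNormedType.Exports.

Local Open Scope ring_scope.

Set Implicit Arguments.
Unset Strict Implicit.
Unset Printing Implicit Defensive.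

Local Open Scope classical_set_scope.

(** Write ||.|| for the norms of all M_n(X), and let X act on H through a
    complete isometry T.

    If T u = 1, then any x in M_n(X) satisfies
    ||(1 + i^k x) v||^2 >= ||v||^2 + 2 Re (i^k <x v, v>).  By polarization the
    norm of x is at most twice the supremum of the numbers Re (i^k <x v, v>)
    over unit vectors v and k < 4, hence max_k ||1 + i^k x||^2 >= 1 + ||x||
    ([unital_pencil_le]).

    Conversely, apply the inequality to t x with t > 0 small.  It yields a
    vector v of norm at most 1 on which u is isometric up to O(t) and with
    |<x v, u v>| >= ||x|| / 2 - O(t) ([almost_norming]).  The errors vanish in
    the limit: let W be the space of bounded sequences in H along which u is
    asymptotically isometric for a free ultrafilter on nat, and let
    B x p q = lim <x p_m, u q_m>.  On W the form B u is the limit of the inner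
    products, so that B behaves like a completely contractive representation of
    X on W sending u to the identity, except that B u is degenerate; and for
    each x in M_n(X) some xi in W^n of norm at most 1 has
    |sum_kl B x_kl xi_l xi_k| >= ||x|| / 2 ([norming_form]).

    Such a B is turned into operators on a Hilbert space without completing W.
    Every finite B u-orthonormal family e gives a matrix (B x e_j e_i)_ij, with
    the identity at x = u.  The direct sum of these matrices over all such
    families acts on an l2 space; it is unital and completely contractive, and
    by Gram--Schmidt it dominates every number |sum_kl B x_kl xi_l zeta_k|
    ([unital_compression]).

    A complete contraction S with the last two properties is a complete
    isometry.  Apply the lower bound to the 2n x 2n matrix with x in its upper
    right corner and 0 elsewhere: if xi = (xi', xi'') has norm at most 1, then
    ||x|| / 2 <= |sum_kl B x_kl xi''_l xi'_k| <= ||S x|| ||xi'|| ||xi''||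
    <= ||S x|| / 2. *)

Local Notation Re := complex.Re.
Local Notation Im := complex.Im.

(** * Complex numbers as pairs of reals *)

Section ComplexAux.
Variable R : realType.
Implicit Types c d : R[i].

(** Norms on R[i] take their values in R[i]; this is the same number as an
    element of R, where suprema, square roots and limits are available. *)
Definition modulus (c : R[i]) : R := Re `|c|.

Lemma modulus_sqrt c : modulus c = Num.sqrt (Re c ^+ 2 + Im c ^+ 2).
Proof. by rewrite /modulus normc_def. Qed.

Lemma normc_modulus c : `|c| = (modulus c)%:C%C.
Proof. by rewrite modulus_sqrt normc_def. Qed.

Lemma modulus_ge0 c : 0 <= modulus c.
Proof. by rewrite modulus_sqrt sqrtr_ge0. Qed.

Lemma Re_le_modulus c : `|Re c| <= modulus c.
Proof.
rewrite modulus_sqrt -sqrtr_sqr ler_wsqrtr // lerDl sqr_ge0 //.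
Qed.

Lemma Im_le_modulus c : `|Im c| <= modulus c.
Proof.
rewrite modulus_sqrt -sqrtr_sqr ler_wsqrtr // lerDr sqr_ge0 //.
Qed.

Lemma modulusM (c d : R[i]) : modulus (c * d) = modulus c * modulus d.
Proof. by apply: (@complexI R); rewrite rmorphM -!normc_modulus normrM. Qed.

Lemma ReM (c d : R[i]) : Re (c * d) = Re c * Re d - Im c * Im d.
Proof. by case: c; case: d. Qed.

Lemma ImM (c d : R[i]) : Im (c * d) = Re c * Im d + Im c * Re d.
Proof. by case: c; case: d. Qed.

Lemma Re_conjc (c : R[i]) : Re (Num.conj c) = Re c.
Proof. by case: c. Qed.

Lemma Im_conjc (c : R[i]) : Im (Num.conj c) = - Im c.
Proof. by case: c. Qed.

Lemma modulus_conj c : modulus (Num.conj c) = modulus c.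
Proof. by rewrite !modulus_sqrt Re_conjc Im_conjc sqrrN. Qed.

Lemma modulus_real (r : R) : 0 <= r -> modulus r%:C%C = r.
Proof. by move=> r0; rewrite modulus_sqrt /= expr0n addr0 sqrtr_sqr ger0_norm. Qed.

Lemma modulus_iX k : modulus ('i%C ^+ k : R[i]) = 1.
Proof.
by apply: (@complexI R);
  rewrite -normc_modulus normrX normc_modulus modulus_sqrt /= expr0n add0r
  expr1n sqrtr1 expr1n.
Qed.

Lemma ge0_Re c : 0 <= c -> c = (Re c)%:C%C.
Proof. by case: c => x y; rewrite lecE /= => /andP[/eqP -> _]. Qed.

End ComplexAux.

(** * Limits of bounded complex functions along an ultrafilter *)

Section UltraLimit.
Variables (R : realType) (T : Type) (U : set_system T).
Hypothesis UU : UltraFilter U.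
Implicit Types (z : T -> R[i]).

Definition cbounded z := exists M : R, forall t, modulus (z t) <= M.

(** Defined through real and imaginary parts; meaningful for bounded z, since
    ultrafilters converge in real segments. *)
Definition ulim z : R[i] :=
  Complex (lim (Re (z t) @[t --> U])) (lim (Im (z t) @[t --> U])).

Let PU : ProperFilter U := ultra_proper.

(** The image of an ultrafilter is an ultrafilter; here it contains a compact
    segment. *)
Lemma bounded_cvg_ultra (a : T -> R) (M : R) :
  (forall t, `|a t| <= M) -> cvg (a t @[t --> U]).
Proof.
move=> aM.
have := @segment_compact R (- M) M; rewrite compact_ultra /=.
move=> /(_ (a @ U) _) [].
- split.
  + exact: fmap_proper_filter.
  + move=> G PG sub; apply/seteqP; split => //.
    move=> A GA; rewrite /fmap /=.
    have [//|h] := in_ultra_setVsetC (a @^-1` A) UU.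
    have : G (~` A) by apply: sub.
    move=> GnA; have := filterI GA GnA; rewrite setICr => G0.
    by case: (@filter_not_empty _ G PG (G0 _)).
- rewrite /fmap /=; apply: filterS (@filterT _ U _) => t _ /=.
  by rewrite in_itv /= -ler_norml.
- by move=> l [_ h]; apply/cvg_ex; exists l.
Qed.

Lemma ulim_Re z : cbounded z -> Re (z t) @[t --> U] --> Re (ulim z).
Proof.
move=> [M zM]; apply: (@bounded_cvg_ultra _ M) => t.
exact: le_trans (Re_le_modulus _) (zM t).
Qed.

Lemma ulim_Im z : cbounded z -> Im (z t) @[t --> U] --> Im (ulim z).
Proof.
move=> [M zM]; apply: (@bounded_cvg_ultra _ M) => t.
exact: le_trans (Im_le_modulus _) (zM t).
Qed.

Lemma ulim_eq z (l : R[i]) :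
  Re (z t) @[t --> U] --> Re l -> Im (z t) @[t --> U] --> Im l ->
  ulim z = l.
Proof.
by rewrite /ulim => /cvg_lim -> // /cvg_lim -> //; case: l.
Qed.

Lemma ulim_cst c : ulim (fun=> c) = c.
Proof. by apply: ulim_eq; apply: cvg_cst. Qed.

Lemma ulimD z1 z2 : cbounded z1 -> cbounded z2 ->
  ulim (fun t => z1 t + z2 t) = ulim z1 + ulim z2.
Proof.
move=> b1 b2; apply: ulim_eq.
  rewrite raddfD /=; under eq_fun do rewrite raddfD.
  by apply: cvgD; apply: ulim_Re.
rewrite raddfD /=; under eq_fun do rewrite raddfD.
by apply: cvgD; apply: ulim_Im.
Qed.

Lemma ulimZ c z : cbounded z -> ulim (fun t => c * z t) = c * ulim z.
Proof.
move=> b; apply: ulim_eq.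
  rewrite ReM; under eq_fun do rewrite ReM.
  by apply: cvgB; apply: cvgMr; [exact: ulim_Re|exact: ulim_Im].
rewrite ImM; under eq_fun do rewrite ImM.
by apply: cvgD; apply: cvgMr; [exact: ulim_Im|exact: ulim_Re].
Qed.

Lemma ulim_conj z : cbounded z -> ulim (fun t => Num.conj (z t)) = Num.conj (ulim z).
Proof.
move=> b; apply: ulim_eq.
  by rewrite Re_conjc; under eq_fun do rewrite Re_conjc; exact: ulim_Re.
by rewrite Im_conjc; under eq_fun do rewrite Im_conjc; apply: cvgN; exact: ulim_Im.
Qed.

Lemma ulim_modulus z : cbounded z -> modulus (z t) @[t --> U] --> modulus (ulim z).
Proof.
move=> b; rewrite modulus_sqrt; under eq_fun do rewrite modulus_sqrt.
apply: continuous_cvg; first exact: sqrt_continuous.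
apply: cvgD; rewrite expr2; under eq_fun do rewrite expr2.
  by apply: cvgM; apply: ulim_Re.
by apply: cvgM; apply: ulim_Im.
Qed.

Lemma ler_filter_lim (f g : T -> R) (l l' : R) :
  f t @[t --> U] --> l -> g t @[t --> U] --> l' -> (forall t, f t <= g t) ->
  l <= l'.
Proof.
move=> fl gl fg; rewrite -subr_ge0; apply: (cvgr_to_ge (cvgB gl fl)).
by apply: nearW => t; rewrite subr_ge0.
Qed.

Lemma ulim_ge0 z : cbounded z -> (forall t, 0 <= z t) -> 0 <= ulim z.
Proof.
move=> b z0; have z0' t : (Im (z t) = 0) * (0 <= Re (z t)).
  by have := z0 t; rewrite lecE => /andP[/eqP].
rewrite lecE; apply/andP; split.
  apply/eqP; rewrite -[RHS](@lim_cst _ (@norm_hausdorff _ _) _ U _ 0).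
  have := ulim_Im b; under eq_fun do rewrite z0'.
  by move=> /cvg_lim <-.
apply: (@ler_filter_lim (fun=> 0) (fun t => Re (z t))).
- exact: cvg_cst.
- exact: ulim_Re.
- by move=> t; rewrite z0'.
Qed.

Lemma cboundedD z1 z2 : cbounded z1 -> cbounded z2 ->
  cbounded (fun t => z1 t + z2 t).
Proof.
move=> [M1 h1] [M2 h2]; exists (M1 + M2) => t.
rewrite -lecR -normc_modulus (le_trans (ler_normD _ _)) //.
by rewrite !normc_modulus -rmorphD lecR lerD.
Qed.

Lemma cboundedZ c z : cbounded z -> cbounded (fun t => c * z t).
Proof.
move=> [M h]; exists (modulus c * M) => t.
by rewrite modulusM ler_wpM2l // modulus_ge0.
Qed.

Lemma cbounded_sum (I : Type) (r : seq I) (z : I -> T -> R[i]) :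
  (forall i, cbounded (z i)) -> cbounded (fun t => \sum_(i <- r) z i t).
Proof.
move=> b; elim: r => [|i r ih].
  by exists 0 => t; rewrite big_nil modulus_sqrt /= expr0n addr0 sqrtr0.
by under eq_fun do rewrite big_cons; apply: cboundedD.
Qed.

Lemma ulim_sum (I : Type) (r : seq I) (z : I -> T -> R[i]) :
  (forall i, cbounded (z i)) ->
  ulim (fun t => \sum_(i <- r) z i t) = \sum_(i <- r) ulim (z i).
Proof.
move=> b; elim: r => [|i r ih].
  by rewrite big_nil -[RHS](ulim_cst 0); congr ulim; apply/funext => t;
    rewrite big_nil.
under eq_fun do rewrite big_cons.
by rewrite big_cons ulimD ?ih //; apply: cbounded_sum.
Qed.

Lemma ulim_eq0 z (a : T -> R) : a t @[t --> U] --> 0 ->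
  (forall t, modulus (z t) <= a t) -> ulim z = 0.
Proof.
move=> a0 za.
have sq (f : R[i] -> R) : (forall c, `|f c| <= modulus c) ->
  f (z t) @[t --> U] --> 0.
  move=> fc; have fa t := le_trans (fc (z t)) (za t).
  apply: (squeeze_cvgr (f := fun t => - a t) (g := fun t => f (z t)) _ _ a0).
    by apply: nearW => t; rewrite -ler_norml.
  by rewrite -oppr0; apply: cvgN.
apply: ulim_eq => /=; apply: sq; [exact: Re_le_modulus|exact: Im_le_modulus].
Qed.

(** Cauchy--Schwarz inequalities are what has to pass to the limit; both sides
    are continuous in the real and imaginary parts. *)
Lemma ulim_CS z a b : cbounded z -> cbounded a -> cbounded b ->
  (forall t, `|z t| ^+ 2 <= a t * b t) ->
  (forall t, 0 <= a t) -> (forall t, 0 <= b t) ->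
  `|ulim z| ^+ 2 <= ulim a * ulim b.
Proof.
move=> bz ba bb h a0 b0.
rewrite (ge0_Re (ulim_ge0 ba a0)) (ge0_Re (ulim_ge0 bb b0)) normc_modulus.
rewrite -rmorphXn -rmorphM lecR.
apply: (@ler_filter_lim (fun t => modulus (z t) ^+ 2)
          (fun t => Re (a t) * Re (b t))).
- rewrite expr2; under eq_fun do rewrite expr2.
  by apply: cvgM; exact: ulim_modulus.
- by apply: cvgM; exact: ulim_Re.
- move=> t; have := h t.
  rewrite (ge0_Re (a0 t)) (ge0_Re (b0 t)) normc_modulus.
  by rewrite -rmorphXn -rmorphM lecR.
Qed.

Lemma ulim_modulus_ge z (a : T -> R) (c : R) : cbounded z -> a t @[t --> U] --> 0 ->
  (forall t, c <= modulus (z t) + a t) -> c <= modulus (ulim z).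
Proof.
move=> bz a0 h; rewrite -[leRHS]addr0.
apply: (@ler_filter_lim (fun=> c) (fun t => modulus (z t) + a t)).
- exact: cvg_cst.
- by apply: cvgD => //; exact: ulim_modulus.
- exact: h.
Qed.
End UltraLimit.

(** * Positive semidefinite sesquilinear forms *)

Section PsdForms.
Variable R : realType.

(** Forms are linear on the left. Degenerate ones are allowed: neither 1 - u^*u
    on H nor the limit form on sequences is definite. *)
Record psd_form (V : lmodType R[i]) (f : V -> V -> R[i]) : Prop := PsdForm {
  psdDl : forall u v w, f (u + v) w = f u w + f v w;
  psdZl : forall c u v, f (c *: u) v = c * f u v;
  psdC : forall u v, f u v = Num.conj (f v u);
  psd_ge0 : forall v, 0 <= f v v
}.

Definition seminorm (V : lmodType R[i]) (f : V -> V -> R[i]) (v : V) : R :=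
  Num.sqrt (Re (f v v)).

Section Theory.
Variables (V : lmodType R[i]) (f : V -> V -> R[i]).
Hypothesis psdf : psd_form f.
Implicit Types u v w : V.

Lemma psdDr u v w : f u (v + w) = f u v + f u w.
Proof. by rewrite psdC // psdDl // rmorphD /= -!psdC. Qed.

Lemma psdZr c u v : f u (c *: v) = Num.conj c * f u v.
Proof. by rewrite psdC // psdZl // rmorphM /= -psdC. Qed.

Lemma psdNl u v : f (- u) v = - f u v.
Proof. by rewrite -scaleN1r psdZl // mulN1r. Qed.

Lemma psdNr u v : f u (- v) = - f u v.
Proof. by rewrite -scaleN1r psdZr // rmorphN rmorph1 mulN1r. Qed.

Lemma psd0l v : f 0 v = 0.
Proof. by rewrite -(scale0r 0) psdZl // mul0r. Qed.

Lemma psd_suml I (r : seq I) (u : I -> V) v :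
  f (\sum_(i <- r) u i) v = \sum_(i <- r) f (u i) v.
Proof.
elim: r => [|i r ih]; first by rewrite !big_nil psd0l.
by rewrite !big_cons psdDl // ih.
Qed.

(** Evaluate the form at f(v,v) u - f(u,v) v.  If f(v,v) = 0 exchange the roles
    of u and v, and if both squares vanish use u - f(u,v) v. *)
Lemma psd_CS u v : `|f u v| ^+ 2 <= f u u * f v v.
Proof.
rewrite normCK; set a := f u u; set b := f v v; set c := f u v.
have ca : Num.conj a = a by rewrite -psdC.
have cb : Num.conj b = b by rewrite -psdC.
have a0 : 0 <= a by apply: psd_ge0.
have b0 : 0 <= b by apply: psd_ge0.
have vu : f v u = Num.conj c by rewrite psdC.
have E (p q : R[i]) : 0 <= p * Num.conj p * a + q * Num.conj q * b
                  + p * Num.conj q * c + q * Num.conj p * Num.conj c.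
  have := psd_ge0 psdf (p *: u + q *: v).
  rewrite (psdDl psdf) !psdDr !(psdZl psdf) !psdZr vu -/a -/b -/c.
  by congr (0 <= _); ring.
have [b_eq0|b_neq0] := eqVneq b 0; last first.
  have := E b (- c); rewrite !rmorphN cb /=.
  rewrite (_ : _ + _ = b * (a * b - c * Num.conj c)); last by ring.
  by rewrite pmulr_rge0 ?subr_ge0 // lt_neqAle eq_sym b_neq0.
have [a_eq0|a_neq0] := eqVneq a 0; last first.
  have := E (- Num.conj c) a; rewrite !rmorphN /= ca (conjCK c).
  rewrite (_ : _ + _ = a * (a * b - c * Num.conj c)); last by ring.
  by rewrite pmulr_rge0 ?subr_ge0 // lt_neqAle eq_sym a_neq0.
have := E 1 (- c); rewrite a_eq0 b_eq0 rmorphN rmorph1 /=.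
rewrite (_ : _ + _ = 2 * (0 * 0 - c * Num.conj c)); last by ring.
by rewrite pmulr_rge0 ?ltr0n // subr_ge0.
Qed.

Lemma seminorm_ge0 v : 0 <= seminorm f v.
Proof. exact: sqrtr_ge0. Qed.

Lemma psd_seminorm v : f v v = (seminorm f v ^+ 2)%:C%C.
Proof.
have h := psd_ge0 psdf v; rewrite /seminorm sqr_sqrtr -?ge0_Re //.
by move: h; rewrite lecE => /andP[].
Qed.

Lemma seminorm0 : seminorm f 0 = 0.
Proof. by rewrite /seminorm psd0l sqrtr0. Qed.

Lemma seminorm_CS u v : modulus (f u v) <= seminorm f u * seminorm f v.
Proof.
rewrite -ler_sqr ?nnegrE ?modulus_ge0 ?mulr_ge0 ?seminorm_ge0 // -lecR rmorphXn /=.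
by rewrite -normc_modulus exprMn rmorphM /= -!psd_seminorm psd_CS.
Qed.

Lemma seminormZ c v : seminorm f (c *: v) = modulus c * seminorm f v.
Proof.
apply/eqP; rewrite -(@eqrXn2 _ 2) // ?mulr_ge0 ?seminorm_ge0 ?modulus_ge0 //.
apply/eqP/(@complexI R); rewrite -psd_seminorm exprMn rmorphM rmorphXn /=.
by rewrite -normc_modulus normCK -psd_seminorm psdZl // psdZr mulrA.
Qed.

Lemma seminorm_sqrD u v :
  seminorm f (u + v) ^+ 2 =
  seminorm f u ^+ 2 + seminorm f v ^+ 2 + Re (f u v) *+ 2.
Proof.
apply: (@complexI R); rewrite -psd_seminorm !rmorphD /= -!psd_seminorm.
rewrite (psdDl psdf) !psdDr (psdC psdf v u) -mulr2n -mulr_natl.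
have := addcJ (f u v); rewrite -[(f u v)^*%C]/(Num.conj (f u v)) => <-.
by ring.
Qed.

Lemma seminormD u v : seminorm f (u + v) <= seminorm f u + seminorm f v.
Proof.
rewrite -ler_sqr ?nnegrE ?addr_ge0 ?seminorm_ge0 // seminorm_sqrD sqrrD.
have : Re (f u v) <= seminorm f u * seminorm f v.
  by apply: le_trans (seminorm_CS u v); apply: le_trans (Re_le_modulus _);
    exact: ler_norm.
by lra.
Qed.

Lemma seminorm_sum (I : Type) (r : seq I) (v : I -> V) :
  seminorm f (\sum_(i <- r) v i) <= \sum_(i <- r) seminorm f (v i).
Proof.
elim: r => [|i r ih]; first by rewrite !big_nil seminorm0.
by rewrite !big_cons (le_trans (seminormD _ _)) // lerD2l.
Qed.

End Theory.

Lemma psd_form_sum (V : lmodType R[i]) (f : V -> V -> R[i]) (I : finType) :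
  psd_form f ->
  psd_form (fun p q : I -> V => \sum_i f (p i) (q i)).
Proof.
move=> psdf; split.
- by move=> u v w; rewrite -big_split; apply: eq_bigr => i _; exact: psdDl.
- by move=> c u v; rewrite mulr_sumr; apply: eq_bigr => i _; exact: psdZl.
- by move=> u v; rewrite rmorph_sum; apply: eq_bigr => i _; exact: psdC.
- by move=> v; apply: sumr_ge0 => i _; apply: psd_ge0.
Qed.

Lemma seminorm_form_sum (V : lmodType R[i]) (f : V -> V -> R[i]) (I : finType)
    (p : I -> V) : psd_form f ->
  seminorm (fun p q : I -> V => \sum_i f (p i) (q i)) p ^+ 2 =
  \sum_i seminorm f (p i) ^+ 2.
Proof.
move=> psdf; apply: (@complexI R).
rewrite -(psd_seminorm (psd_form_sum I psdf)) rmorph_sum.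
by apply: eq_bigr => i _ /=; rewrite -(psd_seminorm psdf).
Qed.

End PsdForms.

(** * Matrices of bounded operators *)

Section HilbertOperators.
Variables (R : realType) (H : hilbertType R).

Local Notation dot := (@hdot R H).

Lemma hdot_psd : psd_form dot.
Proof.
split.
- by move=> u v w; rewrite linearDl.
- by move=> c u v; rewrite linearZl_LR.
- by move=> u v; rewrite hermC mul1r.
- by move=> v; rewrite -hdotE exprn_ge0.
Qed.

Lemma norm_seminorm (v : H) : `|v| = (seminorm dot v)%:C%C.
Proof.
apply/eqP; rewrite -(@eqrXn2 _ 2) ?lecR ?seminorm_ge0 //.
by rewrite hdotE (psd_seminorm hdot_psd) rmorphXn.
Qed.

Definition dotn n (p q : 'I_n -> H) : R[i] := \sum_i dot (p i) (q i).

Lemma dotn_psd n : psd_form (@dotn n).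
Proof. exact: psd_form_sum hdot_psd. Qed.

Lemma l2normE n (v : 'I_n -> H) : l2norm v = seminorm (@dotn n) v.
Proof.
rewrite /l2norm /seminorm; congr Num.sqrt.
apply: (@complexI R); rewrite -ge0_Re ?(psd_ge0 (dotn_psd n)) //.
rewrite rmorph_sum; apply: eq_bigr => i _ /=.
by rewrite rmorphXn /= norm_seminorm (psd_seminorm hdot_psd) rmorphXn.
Qed.

Lemma l2norm_sqr n (v : 'I_n -> H) : l2norm v ^+ 2 = \sum_i seminorm dot (v i) ^+ 2.
Proof.
rewrite l2normE; exact: seminorm_form_sum hdot_psd.
Qed.

Lemma bounded_operator_le (f : H -> H) : bounded_operators f ->
  exists2 M, 0 <= M & forall v, seminorm dot (f v) <= M * seminorm dot v.
Proof.
move=> [lf cf].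
pose g : {linear H -> H} := HB.pack f (GRing.isLinear.Build _ _ _ _ f lf).
have := @continuous_linear_bounded _ _ _ 0 g (cf 0).
move=> /linear_boundedP [M [Mr hM]].
have M1 : M < `|M| + 1 by rewrite (le_lt_trans (real_ler_norm Mr)) // ltrDl.
exists (modulus M + 1); first by rewrite addr_ge0 ?modulus_ge0.
move=> v; have := hM _ M1 v.
have -> : `|M| + 1 = (modulus M + 1)%:C%C by rewrite normc_modulus rmorphD rmorph1.
by rewrite /g /= !norm_seminorm -rmorphM lecR.
Qed.

Section OpNorm.
Variables (n : nat) (A : 'M[H -> H]_n).
Hypothesis bA : forall i j, bounded_operators (A i j).

(** Needed to use opnorm at all: the supremum of an unbounded set is 0 by
    convention. *)
Lemma opnorm_bounded :
  exists2 M, 0 <= M & forall v, l2norm (mxapply A v) <= M * l2norm v.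
Proof.
have /choice [M hM] : forall ij : 'I_n * 'I_n, exists M : R, 0 <= M /\
    forall v, seminorm dot (A ij.1 ij.2 v) <= M * seminorm dot v.
  by move=> ij; have [M M0 h] := bounded_operator_le (bA ij.1 ij.2); exists M.
exists (Num.sqrt (\sum_i (\sum_j M (i, j)) ^+ 2)); first exact: sqrtr_ge0.
move=> v; rewrite -ler_sqr ?nnegrE ?mulr_ge0 ?sqrtr_ge0 //.
have S0 : 0 <= \sum_i (\sum_j M (i, j)) ^+ 2.
  by apply: sumr_ge0 => i _; exact: sqr_ge0.
rewrite exprMn (sqr_sqrtr S0).
rewrite l2norm_sqr mulr_suml; apply: ler_sum => i _.
rewrite -exprMn ler_sqr ?nnegrE ?seminorm_ge0 //; last first.
  rewrite mulr_ge0 ?sqrtr_ge0 //; apply: sumr_ge0 => j _.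
  by have [] := hM (i, j).
rewrite mulr_suml; apply: le_trans (seminorm_sum hdot_psd _ _) _.
apply: ler_sum => j _; have [M0 h] := hM (i, j).
apply: le_trans (h _) _; rewrite ler_wpM2l //.
rewrite -ler_sqr ?nnegrE ?seminorm_ge0 ?sqrtr_ge0 // l2norm_sqr (bigD1 j) //= lerDl.
by apply: sumr_ge0 => k _; exact: sqr_ge0.
Qed.

Lemma opnorm_has_ubound :
  has_ubound [set l2norm (mxapply A v) | v in [set v | l2norm v <= 1]].
Proof.
have [M M0 h] := opnorm_bounded.
exists M => _ [v /= v1 <-]; apply: le_trans (h v) _.
by rewrite -[leRHS]mulr1 ler_wpM2l.
Qed.

Let mxapplyZ c (v : 'I_n -> H) : mxapply A (c *: v) = c *: mxapply A v.
Proof.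
apply/funext => i; rewrite -[RHS]/(c *: \sum_j A i j (v j)) scaler_sumr.
apply: eq_bigr => j _; have [lA _] := bA i j.
exact: scalable_linear lA _ _.
Qed.

Lemma opnorm_ge0 : 0 <= opnorm A.
Proof.
apply: le_trans (ub_le_sup opnorm_has_ubound _); last first.
  exists 0 => //=; by rewrite l2normE (seminorm0 (dotn_psd n)).
by rewrite l2normE seminorm_ge0.
Qed.

Lemma opnorm_mxapply v : l2norm (mxapply A v) <= opnorm A * l2norm v.
Proof.
have [v0|v0] := eqVneq (l2norm v) 0.
  have [M M0 h] := opnorm_bounded.
  by have := h v; rewrite v0 !mulr0.
have vp : 0 < l2norm v by rewrite lt_neqAle eq_sym v0 l2normE seminorm_ge0.
have a1 : modulus ((l2norm v)^-1)%:C%C = (l2norm v)^-1.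
  by rewrite modulus_real // invr_ge0 ltW.
rewrite -ler_pdivrMr // mulrC.
have <- : l2norm (mxapply A (((l2norm v)^-1)%:C%C *: v)) =
  (l2norm v)^-1 * l2norm (mxapply A v).
  by rewrite mxapplyZ !l2normE (seminormZ (dotn_psd n)) -l2normE a1.
apply: (ub_le_sup opnorm_has_ubound); exists (((l2norm v)^-1)%:C%C *: v) => //=.
by rewrite l2normE (seminormZ (dotn_psd n)) -l2normE a1 mulVf.
Qed.

Lemma opnorm_le M : (forall v, l2norm v <= 1 -> l2norm (mxapply A v) <= M) ->
  opnorm A <= M.
Proof.
move=> h; apply: ge_sup.
  exists (l2norm (mxapply A 0)); exists 0 => //=.
  by rewrite l2normE (seminorm0 (dotn_psd n)).
by move=> _ [v /= v1 <-]; exact: h.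
Qed.

Lemma lt_opnorm M : M < opnorm A ->
  exists2 v, l2norm v <= 1 & M < l2norm (mxapply A v).
Proof.
move=> h; have [|_ [v /= v1 <-] hv] := sup_gt _ h.
  exists (l2norm (mxapply A 0)); exists 0 => //=.
  by rewrite l2normE (seminorm0 (dotn_psd n)).
by exists v.
Qed.

End OpNorm.
End HilbertOperators.

(** * Unital operator spaces satisfy the inequality *)

Section NumericalRange.
Variables (R : realType) (V : lmodType R[i]) (f : V -> V -> R[i]).
Hypothesis psdf : psd_form f.

(** The polarization identity expresses 4 <y v, w> through the four values
    i^k <y (v + i^k w), v + i^k w>, whose real parts are at most
    c ||v + i^k w||^2; by the parallelogram law these bounds add up to
    4 c (||v||^2 + ||w||^2).  Take w to be y v divided by its norm. *)
Lemma norm_le_numerical_range (y : V -> V) (c : R) :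
  (forall v w, y (v + w) = y v + y w) ->
  (forall a v, y (a *: v) = a *: y v) ->
  0 <= c ->
  (forall (k : nat) v, Re ('i%C ^+ k * f (y v) v) <= c * seminorm f v ^+ 2) ->
  forall v, seminorm f v <= 1 -> seminorm f (y v) <= 2 * c.
Proof.
move=> yD yZ c0 h v v1.
have i2 : ('i%C : R[i]) * 'i%C = -1 by rewrite -expr2 sqr_i.
have ic : Num.conj ('i%C : R[i]) = - 'i%C by apply/eqP;
  rewrite eq_complex /= oppr0 !eqxx.
have key w : Re (f (y v) w) <= c * (seminorm f v ^+ 2 + seminorm f w ^+ 2).
  pose g k := v + 'i%C ^+ k *: w.
  have pol : 4 * f (y v) w = f (y (g 0%N)) (g 0%N) + 'i%C * f (y (g 1%N)) (g 1%N)
      - f (y (g 2)) (g 2) - 'i%C * f (y (g 3)) (g 3).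
    rewrite /g !expr0 !expr1 (_ : 'i%C ^+ 3 = - 'i%C);
      last by rewrite !exprS expr0 mulr1 i2 mulrN1.
    rewrite sqr_i !yD !yZ !(psdDl psdf) !(psdDr psdf) !(psdZl psdf) !(psdZr psdf).
    rewrite !rmorphN !rmorph1 /= ic.
    rewrite (_ : 4 = 1 - 'i%C * 'i%C + 1 - 'i%C * 'i%C); last by rewrite i2; ring.
    ring: i2.
  have nw k : seminorm f ('i%C ^+ k *: w) ^+ 2 = seminorm f w ^+ 2.
    by rewrite (seminormZ psdf) modulus_iX mul1r.
  have ng k : seminorm f (g k) ^+ 2
      = seminorm f v ^+ 2 + seminorm f w ^+ 2 + Re (f v ('i%C ^+ k *: w)) *+ 2.
    by rewrite /g (seminorm_sqrD psdf) nw.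
  have g0 := ng 0%N; have g1 := ng 1%N; have g2 := ng 2%N; have g3 := ng 3%N.
  have i3 : ('i%C : R[i]) ^+ 3 = - 'i%C by rewrite !exprS expr0 mulr1 i2 mulrN1.
  rewrite sqr_i scaleN1r (psdNr psdf) raddfN /= in g2.
  rewrite i3 scaleNr (psdNr psdf) raddfN /= in g3.
  rewrite expr0 scale1r in g0; rewrite expr1 in g1.
  have := h 0%N (g 0%N); have := h 1%N (g 1%N); have := h 2%N (g 2%N);
    have := h 3%N (g 3%N).
  rewrite expr0 expr1 sqr_i i3 mul1r mulN1r mulNr.
  have := congr1 (@complex.Re R) pol;
    rewrite !raddfD !raddfN /= mulr_natl raddfMn /=.
  rewrite g0 g1 g2 g3.
  by lra.
have [r0|r0] := eqVneq (seminorm f (y v)) 0; first by rewrite r0 mulr_ge0.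
have rp : 0 < seminorm f (y v) by rewrite lt_neqAle eq_sym r0 seminorm_ge0.
set r := seminorm f (y v) in r0 rp *.
have := key ((r^-1)%:C%C *: y v).
have a1 : modulus (r^-1)%:C%C = r^-1.
  by rewrite modulus_real // invr_ge0 ltW.
rewrite (seminormZ psdf) a1 -/r mulVf // (psdZr psdf).
rewrite (_ : Num.conj _ = (r^-1)%:C%C); last by apply/eqP;
  rewrite eq_complex /= oppr0 !eqxx.
rewrite (psd_seminorm psdf) -/r -rmorphM /= expr2 mulKf //.
move=> h1; apply: le_trans h1 _; rewrite mulrC ler_wpM2r // expr1n.
have : seminorm f v ^+ 2 <= 1 by rewrite expr_le1 // seminorm_ge0.
by lra.
Qed.
End NumericalRange.
Section CompleteIsometry.
Variables (R : realType) (X : operatorSpace R) (H : hilbertType R).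
Variable T : {linear X -> (H -> H)}.
Hypothesis cT : complete_isometry (@mxnorm R X) T.

Definition act n (x : 'M[X]_n) : ('I_n -> H) -> ('I_n -> H) := mxapply (map_mx T x).

Lemma act_sum n (x : 'M[X]_n) v i : act x v i = \sum_j T (x i j) (v j).
Proof. by apply: eq_bigr => j _; rewrite mxE. Qed.

Lemma rep_linear (x : X) a p q : T x (a *: p + q) = a *: T x p + T x q.
Proof. by have [h _] := cT.1 x; exact: h. Qed.

Lemma rep_addv (x : X) p q : T x (p + q) = T x p + T x q.
Proof. by rewrite -{1}(scale1r p) rep_linear scale1r. Qed.

Lemma rep_0v (x : X) : T x 0 = 0.
Proof. by apply: (addrI (T x 0)); rewrite -rep_addv !addr0. Qed.

Lemma rep_scalev (x : X) a p : T x (a *: p) = a *: T x p.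
Proof. by rewrite -[a *: p]addr0 rep_linear rep_0v addr0. Qed.

Lemma rep_addx x y p : T (x + y) p = T x p + T y p.
Proof. by rewrite linearD. Qed.

Lemma rep_scalex a x p : T (a *: x) p = a *: T x p.
Proof. by rewrite linearZ. Qed.

Lemma rep_0x p : T 0 p = 0.
Proof. by rewrite linear0. Qed.

Lemma actD n (x : 'M[X]_n) p q : act x (p + q) = act x p + act x q.
Proof.
apply/funext => i; rewrite -[RHS]/(act x p i + act x q i) !act_sum -big_split.
by apply: eq_bigr => j _; exact: rep_addv.
Qed.

Lemma actZ n (x : 'M[X]_n) a p : act x (a *: p) = a *: act x p.
Proof.
apply/funext => i; rewrite -[RHS]/(a *: act x p i) !act_sum scaler_sumr.
by apply: eq_bigr => j _; exact: rep_scalev.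
Qed.

Lemma act_pencil n (u : X) (x : 'M[X]_n) c v :
  act (diag_amp u n + scale_entries c x) v = (fun i => T u (v i)) + c *: act x v.
Proof.
apply/funext => i; rewrite -[RHS]/(T u (v i) + c *: act x v i) !act_sum.
under eq_bigr do rewrite !mxE rep_addx rep_scalex.
rewrite big_split scaler_sumr; congr (_ + _).
rewrite (bigD1 i) //= eqxx mulr1n big1 ?addr0 // => j ji.
by rewrite eq_sym (negbTE ji) mulr0n rep_0x.
Qed.

Lemma rep_mx_bounded n (x : 'M[X]_n) i j : bounded_operators (map_mx T x i j).
Proof. by rewrite mxE; exact: cT.1. Qed.

Lemma act_le n (x : 'M[X]_n) v : (0 < n)%N ->
  seminorm (@dotn R H n) (act x v) <= mxnorm x * seminorm (@dotn R H n) v.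
Proof.
move=> n0; rewrite -!l2normE -cT.2 //.
by apply: opnorm_mxapply; exact: rep_mx_bounded.
Qed.

Lemma mxnorm_ge0 n (x : 'M[X]_n) : (0 < n)%N -> 0 <= mxnorm x.
Proof. by move=> n0; rewrite -cT.2 //; apply: opnorm_ge0; exact: rep_mx_bounded. Qed.

Lemma rep_le (x : X) v : seminorm (@hdot R H) (T x v) <=
  Re `|x| * seminorm (@hdot R H) v.
Proof.
rewrite mxnorm1 /=.
have := @act_le 1 (const_mx x) (fun=> v) isT; rewrite /seminorm /dotn !big_ord1.
by rewrite act_sum big_ord1 mxE.
Qed.

Lemma lt_mxnorm n (x : 'M[X]_n) M : (0 < n)%N -> M < mxnorm x ->
  exists2 v, seminorm (@dotn R H n) v <= 1 & M < seminorm (@dotn R H n) (act x v).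
Proof.
move=> n0; rewrite -cT.2 // => /lt_opnorm -[v v1 hv].
by exists v; rewrite -l2normE.
Qed.

Lemma mxnorm_le n (x : 'M[X]_n) M : (0 < n)%N ->
  (forall v, seminorm (@dotn R H n) v <= 1 ->
    seminorm (@dotn R H n) (act x v) <= M) ->
  mxnorm x <= M.
Proof.
move=> n0 h; rewrite -cT.2 //; apply: opnorm_le => v.
by rewrite !l2normE; exact: h.
Qed.

End CompleteIsometry.

Lemma opspace_mxnorm_ge0 (R : realType) (X : operatorSpace R) n (x : 'M[X]_n) :
  (0 < n)%N -> 0 <= mxnorm x.
Proof. by have [H [T cT]] := opspace_repr X; exact: mxnorm_ge0 cT n x. Qed.

(** If b is the maximum, then ||v + i^k x v|| <= b ||v|| gives
    2 Re (i^k <x v, v>) <= (b^2 - 1) ||v||^2, and [norm_le_numerical_range]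
    turns this into ||x|| <= b^2 - 1. *)
Lemma unital_pencil_le (R : realType) (X : operatorSpace R) (u : X) n (x : 'M[X]_n) :
  unital_operator_space u -> (0 < n)%N ->
  Num.sqrt (1 + mxnorm x) <=
  \big[Num.max/0]_(k < 4) mxnorm (diag_amp u n + scale_entries ('i%C ^+ k) x).
Proof.
move=> [H [T [[v0 v0n] cT Tu]]] n0.
set b := \big[_/_]_(_ < _) _.
have b0 : 0 <= b.
  exact: bigmax_ge_id.
have hb (k : 'I_4) v : seminorm (@dotn R H n) (v + 'i%C ^+ k *: act T x v) <=
  b * seminorm (@dotn R H n) v.
  apply: le_trans (_ : _ <=
    mxnorm (diag_amp u n + scale_entries ('i%C ^+ k) x) *
    seminorm (@dotn R H n) v) _.
    have := act_le cT (diag_amp u n + scale_entries ('i%C ^+ k) x) v n0.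
    by rewrite act_pencil Tu.
  by rewrite ler_wpM2r ?seminorm_ge0 // /b; apply: (le_bigmax _ _ k).
have psdn := @dotn_psd R H n.
pose c := (b ^+ 2 - 1) / 2.
have hc (k : nat) v : Re ('i%C ^+ k * dotn (act T x v) v) <=
  c * seminorm (@dotn R H n) v ^+ 2.
  pose k4 : 'I_4 := inord (k %% 4).
  have -> : ('i%C : R[i]) ^+ k = 'i%C ^+ k4.
    rewrite inordK ?ltn_mod // {1}(divn_eq k 4) exprD mulnC exprM.
    by rewrite (_ : 'i%C ^+ 4 = 1) ?expr1n ?mul1r //
      (exprM _ 2 2) sqr_i sqrrN expr1n.
  have := hb k4 v; rewrite addrC -ler_sqr ?nnegrE ?mulr_ge0 ?seminorm_ge0 //.
  rewrite (seminorm_sqrD psdn) (psdZl psdn) exprMn /c.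
  have := sqr_ge0 (seminorm (@dotn R H n) ('i%C ^+ k4 *: act T x v)).
  by lra.
have c0 : 0 <= c.
  (* H is nonzero, and the bounds for k = 0 and k = 2 add up to 0. *)
  pose w : 'I_n -> H := fun i => if i == Ordinal n0 then v0 else 0.
  have wp : 0 < seminorm (@dotn R H n) w.
    rewrite lt_neqAle eq_sym seminorm_ge0 andbT; apply/eqP => w0.
    have : dotn w w = 0 by rewrite (psd_seminorm psdn) w0 expr0n.
    rewrite /dotn (bigD1 (Ordinal n0)) //= /w eqxx big1 => [|i /negbTE ->];
      last first.
      by rewrite psd0l //; exact: hdot_psd.
    rewrite addr0 => /eqP; rewrite -hdotE expf_eq0 normr_eq0 /=.
    by rewrite (negbTE v0n).
  have := hc 0%N w; have := hc 2%N w; rewrite expr0 sqr_i mul1r mulN1r raddfN /=.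
  move=> h1 h2; have : 0 <= c * seminorm (@dotn R H n) w ^+ 2 by lra.
  by rewrite pmulr_lge0 // exprn_gt0.
have : mxnorm x <= 2 * c.
  apply: (mxnorm_le cT) => // v v1.
  apply: (norm_le_numerical_range psdn _ _ c0 hc v1).
    by move=> p q; rewrite (actD cT).
  by move=> a p; rewrite (actZ cT).
rewrite /c mulrC divfK // => hx.
by rewrite -[leRHS]ger0_norm // -sqrtr_sqr ler_wsqrtr //; lra.
Qed.

(** * The Hilbert space of square-summable families *)

Section L2Space.
Variables (R : realType) (I : choiceType).

Definition psum (F : {fset I}) (f g : I -> R[i]) : R[i] :=
  \sum_(i <- F) f i * Num.conj (g i).

Lemma psum_psd F : psd_form (psum F).
Proof.
split.
- move=> f g h; rewrite /psum -big_split; apply: eq_bigr => i _ /=.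
  by rewrite -mulrDl.
- move=> c f g; rewrite /psum mulr_sumr; apply: eq_bigr => i _ /=.
  by rewrite mulrA.
- move=> f g; rewrite /psum rmorph_sum; apply: eq_bigr => i _ /=.
  by rewrite rmorphM /= conjCK mulrC.
- move=> f; apply: sumr_ge0 => i _.
  by rewrite -normCK exprn_ge0.
Qed.

(** Square-summability, through the norms of the restrictions to finite sets. *)
Definition l2fun : {pred I -> R[i]} :=
  fun f => `[< exists M : R, forall F, seminorm (psum F) f <= M >].

Lemma l2fun_submod_closed : submod_closed l2fun.
Proof.
split.
  apply/asboolP; exists 0 => F; by rewrite (seminorm0 (psum_psd F)).
move=> c f g /asboolP[M hf] /asboolP[N hg].
apply/asboolP; exists (modulus c * M + N) => F.
apply: le_trans (seminormD (psum_psd F) _ _) _.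
by rewrite lerD // (seminormZ (psum_psd F)) ler_wpM2l // modulus_ge0.
Qed.
HB.instance Definition _ :=
  GRing.isSubmodClosed.Build R[i] (I -> R[i]) l2fun l2fun_submod_closed.

Record l2 := L2 { l2val :> I -> R[i]; l2valP : l2val \in l2fun }.
HB.instance Definition _ := [isSub for l2val].
HB.instance Definition _ := [Choice of l2 by <:].
HB.instance Definition _ := [SubChoice_isSubLmodule of l2 by <:].

Lemma l2_bounded (f : l2) : exists M : R, forall F, seminorm (psum F) f <= M.
Proof. by have /asboolP := l2valP f. Qed.

Lemma l2_inj (f g : l2) : (forall i, f i = g i) -> f = g.
Proof. by move=> h; apply: val_inj; apply/funext => i; exact: h. Qed.

(** Infinite sums are limits of finite ones along an ultrafilter on the finite
    sets: products of square-summable families have bounded partial sums, so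
    that their limits exist, and refining the inclusion filter makes the
    limit dominate every partial sum of squares. *)
Definition finer_sets : set_system {fset I} :=
  filter_from setT (fun A => [set B | fsubset A B]).

Instance finer_sets_filter : ProperFilter finer_sets.
Proof.
eapply filter_from_proper; last by move=> A _; exists A => /=; exact: fsubset_refl.
apply: filter_fromT_filter; first by exists fset0.
by move=> A B /=; exists (fsetU A B) => P /=; rewrite fsubUset => /andP[].
Qed.

Definition l2_ultra : set_system {fset I} :=
  sval (cid (ultraFilterLemma finer_sets_filter)).

Lemma l2_ultraP : UltraFilter l2_ultra.
Proof. by rewrite /l2_ultra; case: cid => G []. Qed.

Lemma l2_ultra_finer (A : {fset I}) : l2_ultra [set B | fsubset A B].
Proof.
rewrite /l2_ultra; case: cid => G [_ sG] /=; apply: sG.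
by exists A.
Qed.

Definition l2dot (f g : l2) : R[i] := ulim l2_ultra (fun F => psum F f g).

Lemma cbounded_psum (f g : l2) : cbounded (fun F => psum F f g).
Proof.
have [M hM] := l2_bounded f; have [N hN] := l2_bounded g.
exists (M * N) => F; apply: le_trans (seminorm_CS (psum_psd F) _ _) _.
by rewrite ler_pM ?seminorm_ge0.
Qed.

Lemma l2dot_psd : psd_form l2dot.
Proof.
have U := l2_ultraP; split.
- move=> u v w; rewrite /l2dot -(ulimD U); [|exact: cbounded_psum..].
  by congr ulim; apply/funext => F; exact: (psdDl (psum_psd F)).
- move=> c u v; rewrite /l2dot -(ulimZ U); last exact: cbounded_psum.
  by congr ulim; apply/funext => F; exact: (psdZl (psum_psd F)).
- move=> u v; rewrite /l2dot -(ulim_conj U); last exact: cbounded_psum.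
  by congr ulim; apply/funext => F; exact: (psdC (psum_psd F)).
- move=> v; apply: (ulim_ge0 U (cbounded_psum _ _)) => F.
  exact: (psd_ge0 (psum_psd F)).
Qed.

Lemma psum_sqr F f : psum F f f = (\sum_(i <- F) modulus (f i) ^+ 2)%:C%C.
Proof.
rewrite /psum rmorph_sum; apply: eq_bigr => i _ /=.
by rewrite -normCK normc_modulus rmorphXn.
Qed.

Lemma seminorm_psum F f : seminorm (psum F) f ^+ 2 =
  \sum_(i <- F) modulus (f i) ^+ 2.
Proof. by apply: (@complexI R); rewrite -(psd_seminorm (psum_psd F)) psum_sqr. Qed.

Lemma psum_split (V : nmodType) (F G : {fset I}) (a : I -> V) : fsubset F G ->
  \sum_(i <- G) a i = \sum_(i <- F) a i + \sum_(i <- G | i \notin F) a i.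
Proof.
move=> FG; rewrite (bigID (mem F)) /=; congr (_ + _).
rewrite -big_filter; apply: perm_big; apply: uniq_perm => [||i].
- by rewrite filter_uniq // fset_uniq.
- exact: fset_uniq.
- by rewrite mem_filter; apply: andb_idr; exact: (fsubsetP FG).
Qed.

Lemma psum_mono (F G : {fset I}) (a : I -> R) : fsubset F G ->
  (forall i, 0 <= a i) ->
  \sum_(i <- F) a i <= \sum_(i <- G) a i.
Proof. by move=> FG a0; rewrite (psum_split _ FG) lerDl sumr_ge0. Qed.

(** A finitely supported family is square-summable, with the norm that one
    expects. *)
Lemma psum_support (F G : {fset I}) f : (forall i, i \notin G -> f i = 0) ->
  seminorm (psum F) f <= seminorm (psum G) f.
Proof.
move=> f0; rewrite -ler_sqr ?nnegrE ?seminorm_ge0 // !seminorm_psum.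
apply: le_trans (_ : _ <= \sum_(i <- fsetU G F) modulus (f i) ^+ 2) _.
  by apply: psum_mono => [|i]; [exact: fsubsetUr|exact: sqr_ge0].
rewrite (psum_split _ (fsubsetUl G F)) [X in _ + X]big1 ?addr0 // => i iG.
by rewrite f0 // modulus_sqrt /= expr0n addr0 sqrtr0 expr0n.
Qed.

Lemma psum_le_l2 (f : l2) F : seminorm (psum F) f <= seminorm l2dot f.
Proof.
have U := l2_ultraP.
have PU : ProperFilter l2_ultra := ultra_proper.
apply: ler_wsqrtr; apply: (cvgr_to_ge (ulim_Re U (cbounded_psum f f))).
apply: filterS (l2_ultra_finer F) => G /= FG.
rewrite !psum_sqr /=; apply: psum_mono => // i; exact: sqr_ge0.
Qed.

Lemma coord_le_l2 (f : l2) i : modulus (f i) <= seminorm l2dot f.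
Proof.
apply: le_trans (psum_le_l2 f [fset i]%fset).
rewrite -ler_sqr ?nnegrE ?modulus_ge0 ?seminorm_ge0 // seminorm_psum.
by rewrite big_seq_fset1.
Qed.

(** The bound on partial sums is only assumed for the whole tuple: this is how
    norms of operator matrices are estimated. *)
Lemma l2_sum_le N (p : 'I_N -> l2) M :
  (forall F, \sum_l seminorm (psum F) (p l) ^+ 2 <= M) ->
  \sum_l seminorm l2dot (p l) ^+ 2 <= M.
Proof.
move=> h; have U := l2_ultraP.
apply: (ler_filter_lim U (f := fun F => Re (\sum_l psum F (p l) (p l)))
  (g := fun=> M)) => //.
- rewrite (_ : \sum_l _ = Re (ulim l2_ultra (fun F => \sum_l psum F (p l) (p l)))).
    apply: (ulim_Re U); apply: cbounded_sum => l; exact: cbounded_psum.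
  rewrite (ulim_sum U) => [|l]; last exact: cbounded_psum.
  apply: (@complexI R); rewrite -ge0_Re.
    rewrite rmorph_sum; apply: eq_bigr => l _ /=.
    by rewrite -(psd_seminorm l2dot_psd).
  apply: sumr_ge0 => l _; exact: (psd_ge0 l2dot_psd).
- exact: cvg_cst.
- move=> F; apply: le_trans (h F); rewrite le_eqVlt; apply/orP; left; apply/eqP.
  apply: (@complexI R); rewrite -ge0_Re ?rmorph_sum.
    by apply: eq_bigr => l _ /=; rewrite -(psd_seminorm (psum_psd F)).
  by apply: sumr_ge0 => l _; exact: (psd_ge0 (psum_psd F)).
Qed.

Lemma l2_le (f : l2) M : 0 <= M -> (forall F, seminorm (psum F) f <= M) ->
  seminorm l2dot f <= M.
Proof.
move=> M0 h; rewrite -ler_sqr ?nnegrE ?seminorm_ge0 //.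
have := @l2_sum_le 1 (fun=> f) (M ^+ 2); rewrite big_ord1; apply => F.
by rewrite big_ord1 ler_sqr ?nnegrE ?seminorm_ge0.
Qed.

Definition l2_norm (f : l2) : R[i] := (seminorm l2dot f)%:C%C.

Lemma l2_normD f g : l2_norm (f + g) <= l2_norm f + l2_norm g.
Proof. by rewrite -rmorphD lecR seminormD //; exact: l2dot_psd. Qed.

Lemma l2_normZ c f : l2_norm (c *: f) = `|c| * l2_norm f.
Proof. by rewrite /l2_norm (seminormZ l2dot_psd) rmorphM normc_modulus. Qed.

Lemma l2_norm_eq0 f : l2_norm f = 0 -> f = 0.
Proof.
move=> /complexI f0; apply: l2_inj => i.
apply/eqP; rewrite -normr_eq0 normc_modulus; apply/eqP; congr (_ %:C%C).
by apply/eqP; rewrite eq_le modulus_ge0 andbT -f0 coord_le_l2.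
Qed.

HB.instance Definition _ :=
  Lmodule_isNormed.Build R[i] l2 l2_normD l2_normZ l2_norm_eq0.

Lemma l2_normE (f : l2) : `|f| = (seminorm l2dot f)%:C%C.
Proof. by []. Qed.

Section Completeness.
Variable F : set_system l2.
Hypotheses (PF : ProperFilter F) (cF : cauchy F).

Let small_ball (e : R) : 0 < e ->
  exists x : l2, F [set f | seminorm l2dot (x - f) < e].
Proof.
move=> e0; have /cauchyP /(_ e%:C%C) := cF; rewrite ltcR => /(_ e0) [x hx].
exists x; apply: filterS hx => f; rewrite -ball_normE /= l2_normE ltcR.
done.
Qed.

Let coord_cvg (c : R[i] -> R) i :
  (forall a b, c (a - b) = c a - c b) -> (forall a, `|c a| <= modulus a) ->
  cvg ((fun f : l2 => c (f i)) @ F).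
Proof.
move=> cB cle; apply: R_complete; apply/cauchyP => e e0.
have [x hx] := small_ball e0; exists (c (x i)).
change (F [set f : l2 | ball (c (x i)) e (c (f i))]).
apply: filterS hx => f fx; rewrite /= -ball_normE /ball_ /= -cB.
apply: le_lt_trans fx; apply: le_trans (cle _) _.
exact: (coord_le_l2 (x - f) i).
Qed.

Let lim_fun i : R[i] :=
  Complex (lim ((fun f : l2 => Re (f i)) @ F))
          (lim ((fun f : l2 => Im (f i)) @ F)).

Let lim_modulus (x : l2) i :
  (fun f : l2 => modulus (x i - f i) ^+ 2) @ F --> modulus (x i - lim_fun i) ^+ 2.
Proof.
have sqE (c : R[i]) : modulus c ^+ 2 = Re c ^+ 2 + Im c ^+ 2.
  by rewrite modulus_sqrt sqr_sqrtr // addr_ge0 ?sqr_ge0.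
under eq_fun do rewrite sqE; rewrite sqE.
have cR : (fun f : l2 => Re (x i - f i)) @ F --> Re (x i - lim_fun i).
  rewrite raddfB /=; under eq_fun do rewrite raddfB /=.
  apply: cvgB; first exact: cvg_cst.
  by apply: (@coord_cvg (@complex.Re R) i) => [a b|a];
    [rewrite raddfB|exact: Re_le_modulus].
have cI : (fun f : l2 => Im (x i - f i)) @ F --> Im (x i - lim_fun i).
  rewrite raddfB /=; under eq_fun do rewrite raddfB /=.
  apply: cvgB; first exact: cvg_cst.
  by apply: (@coord_cvg (@complex.Im R) i) => [a b|a];
    [rewrite raddfB|exact: Im_le_modulus].
by apply: cvgD; rewrite expr2; under eq_fun do rewrite expr2; apply: cvgM.
Qed.

(** On a finite set of coordinates the distance to the coordinatewise limit is
    the limit of the distances, which are bounded by e independently of the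
    finite set. *)
Let lim_psum (x : l2) (e : R) (S : {fset I}) : 0 < e ->
  F [set f | seminorm l2dot (x - f) < e] ->
  seminorm (psum S) ((x : I -> R[i]) - lim_fun) <= e.
Proof.
move=> e0 hx; rewrite -ler_sqr ?nnegrE ?seminorm_ge0 ?(ltW e0) // seminorm_psum.
apply: (cvgr_to_le (f := fun f : l2 =>
  \sum_(i <- S) modulus (x i - f i) ^+ 2) (F := F)).
  elim: (enum_fset S) => [|i r ih].
    by rewrite big_nil; under eq_fun do rewrite big_nil; exact: cvg_cst.
  rewrite big_cons; under eq_fun do rewrite big_cons.
  by apply: cvgD => //; exact: lim_modulus.
apply: filterS hx => f /= fx.
rewrite -(seminorm_psum S ((x : I -> R[i]) - f)) ler_sqr ?nnegrE ?seminorm_ge0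
  ?(ltW e0) //.
exact: le_trans (psum_le_l2 (x - f) S) (ltW fx).
Qed.

Lemma l2_cauchy_cvg : cvg F.
Proof.
have lim_l2 : lim_fun \in l2fun.
  have [x hx] := small_ball ltr01.
  have -> : lim_fun = (x : I -> R[i]) - ((x : I -> R[i]) - lim_fun).
    by rewrite opprB addrC subrK.
  apply: rpredB; first exact: l2valP.
  by apply/asboolP; exists 1 => S; exact: lim_psum.
pose l := L2 lim_l2.
apply/cvg_ex; exists l; apply/cvgrPdist_lt => e;
  rewrite ltcE /= => /andP[/eqP ei e0].
have -> : e = (Re e)%:C%C by case: e ei {e0} => a b /= ->.
have e3 : 0 < Re e / 3 by rewrite divr_gt0.
have [x hx] := small_ball e3.
have xl : seminorm l2dot (x - l) <= Re e / 3.
  by apply: l2_le => [|S]; [exact: ltW|exact: lim_psum].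
apply: filterS hx => f /= fx.
rewrite l2_normE ltcR.
have -> : l - f = (x - f) + (-1) *: (x - l).
  by rewrite scaleN1r opprB [RHS]addrC addrA subrK.
apply: le_lt_trans (seminormD l2dot_psd _ _) _.
rewrite (seminormZ l2dot_psd) (_ : modulus (-1) = 1); last first.
  by rewrite modulus_sqrt /= sqrrN expr1n oppr0 expr0n addr0 sqrtr1.
by lra.
Qed.
End Completeness.

HB.instance Definition _ := Uniform_isComplete.Build l2 l2_cauchy_cvg.

Lemma l2dot_bilinear : bilinear_for ( *%R) (Num.conj \; *%R) l2dot.
Proof.
split.
- by move=> v c u w; rewrite (psdDl l2dot_psd) (psdZl l2dot_psd).
- by move=> v c u w; rewrite (psdDr l2dot_psd) (psdZr l2dot_psd).
Qed.

HB.instance Definition _ :=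
  bilinear_isBilinear.Build R[i] l2 l2 R[i] ( *%R) (Num.conj \; *%R)
    l2dot l2dot_bilinear.

Lemma l2dot_herm f g : l2dot f g = (-1) ^+ false * Num.conj (l2dot g f).
Proof. by rewrite mul1r -(psdC l2dot_psd). Qed.

HB.instance Definition _ :=
  isHermitianSesquilinear.Build R[i] l2 false Num.conj l2dot l2dot_herm.

Lemma l2dot_def f : f != 0 -> 0 < l2dot f f.
Proof.
move=> f0; rewrite lt_neqAle (psd_ge0 l2dot_psd) andbT eq_sym.
rewrite (psd_seminorm l2dot_psd) rmorphXn expf_eq0 /=.
by rewrite -l2_normE normr_eq0.
Qed.

HB.instance Definition _ := isDotProduct.Build R[i] l2 l2dot l2dot_def.

Lemma l2_normsq (f : l2) : `|f| ^+ 2 = l2dot f f.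
Proof. by rewrite l2_normE (psd_seminorm l2dot_psd) rmorphXn. Qed.

Definition l2_hilbert : hilbertType R := @HilbertType R l2 l2dot l2_normsq.

End L2Space.

(** * Compressions of a sesquilinear representation *)

Definition amp_form (R : realType) (X : operatorSpace R) (u : X) (W : lmodType R[i])
    (B : X -> W -> W -> R[i]) n (p q : 'I_n -> W) : R[i] := \sum_i B u (p i) (q i).

(** The properties of B x p q = <x p, u q> for p and q in a space on which u is
    isometric: sesquilinearity, the inner product B u, and complete
    contractivity. *)
Record unital_form (R : realType) (X : operatorSpace R) (u : X)
    (W : lmodType R[i]) (B : X -> W -> W -> R[i]) : Prop := UnitalForm {
  form_linx : forall a x y p q, B (a *: x + y) p q = a * B x p q + B y p q;
  form_linl : forall x a p p' q, B x (a *: p + p') q = a * B x p q + B x p' q;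
  form_linr : forall x a p q q',
    B x p (a *: q + q') = Num.conj a * B x p q + B x p q';
  form_psd : psd_form (B u);
  form_le : forall n (x : 'M[X]_n) (p q : 'I_n -> W), (0 < n)%N ->
    modulus (\sum_k \sum_l B (x k l) (p l) (q k)) <=
    mxnorm x * seminorm (@amp_form R X u W B n) p *
      seminorm (@amp_form R X u W B n) q
}.

Section Dilation.
Variables (R : realType) (X : operatorSpace R) (u : X) (W : lmodType R[i]).
Variable B : X -> W -> W -> R[i].
Hypothesis ufB : unital_form u B.

Let BxL := form_linx ufB.
Let BlL := form_linl ufB.
Let BrL := form_linr ufB.
Let g_psd := form_psd ufB.
Let B_le := form_le ufB.
Local Notation amp_form := (@amp_form R X u W B).

Let amp_form_psd n : psd_form (@amp_form n).
Proof. exact: psd_form_sum. Qed.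

Lemma form_suml x I (r : seq I) (c : I -> R[i]) (p : I -> W) q :
  B x (\sum_(i <- r) c i *: p i) q = \sum_(i <- r) c i * B x (p i) q.
Proof.
elim: r => [|i r ih]; last by rewrite !big_cons BlL ih.
by rewrite !big_nil; have := BlL x (-1) 0 0 q;
  rewrite scaleN1r oppr0 addr0 mulN1r addNr.
Qed.

Lemma form_sumr x I (r : seq I) (c : I -> R[i]) (p : I -> W) q :
  B x q (\sum_(i <- r) c i *: p i) = \sum_(i <- r) Num.conj (c i) * B x q (p i).
Proof.
elim: r => [|i r ih]; last by rewrite !big_cons BrL ih.
rewrite !big_nil; have := BrL x (-1) q 0 0.
by rewrite scaleN1r oppr0 addr0 rmorphN rmorph1 mulN1r addNr.
Qed.

Lemma form_nulll x p q : B u p p = 0 -> B x p q = 0.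
Proof.
move=> p0; have := @B_le 1 (const_mx x) (fun=> p) (fun=> q) isT.
rewrite !big_ord1 mxE [seminorm _ (fun=> p)]/seminorm /amp_form !big_ord1 p0 sqrtr0.
rewrite mulr0 mul0r => h; apply/eqP; rewrite -normr_eq0 normc_modulus.
by apply/eqP; congr (_ %:C%C); apply/eqP; rewrite eq_le h modulus_ge0.
Qed.

Lemma form_nullr x p q : B u q q = 0 -> B x p q = 0.
Proof.
move=> q0; have := @B_le 1 (const_mx x) (fun=> p) (fun=> q) isT.
rewrite !big_ord1 mxE [seminorm _ (fun=> q)]/seminorm /amp_form !big_ord1 q0 sqrtr0.
rewrite mulr0 => h; apply/eqP; rewrite -normr_eq0 normc_modulus.
by apply/eqP; congr (_ %:C%C); apply/eqP; rewrite eq_le h modulus_ge0.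
Qed.

Lemma form_eql x p p' q : B u (p - p') (p - p') = 0 -> B x p q = B x p' q.
Proof.
move=> p0; rewrite -[in LHS](subrK p' p) -[p - p']scale1r BlL.
by rewrite form_nulll ?mulr0 ?add0r.
Qed.

Lemma form_eqr x p q q' : B u (q - q') (q - q') = 0 -> B x p q = B x p q'.
Proof.
move=> q0; rewrite -[in LHS](subrK q' q) -[q - q']scale1r BrL.
by rewrite form_nullr ?mulr0 ?add0r.
Qed.

(** Finite B u-orthonormal families; only the first bdim vectors count. *)
Record block := Block {
  bdim : nat;
  bvec : nat -> W;
  bvecP : forall i j, (i < bdim)%N -> (j < bdim)%N -> B u (bvec i) (bvec j) =
    (i == j)%:R
}.

(** Gram--Schmidt for the degenerate form B u: a residual of norm zero is
    discarded, so each vector is recovered up to a null vector only. *)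
Lemma gram_schmidt (r : seq W) : exists b : block,
  forall v, v \in r -> exists c : nat -> R[i],
    let w := v - \sum_(j < bdim b) c j *: bvec b j in B u w w = 0.
Proof.
elim: r => [|v r [[d e on] ih]].
  by exists (@Block 0 (fun=> 0) (fun i j h => False_ind _ (notF h))).
rewrite /= in ih.
pose w := v - \sum_(j < d) B u v (e j) *: e j.
have wj j : (j < d)%N -> B u w (e j) = 0.
  move=> jd; rewrite /w (psdDl g_psd) (psdNl g_psd) form_suml.
  rewrite (bigD1 (Ordinal jd)) //= on // eqxx mulr1 big1 ?addr0 ?subrr // => i ij.
  by rewrite on //; move: ij; rewrite -val_eqE /= => /negbTE ->; rewrite mulr0.
have [w0|w0] := eqVneq (B u w w) 0.
  exists (Block on) => v'; rewrite inE => /orP[/eqP -> /=|/ih //].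
  by exists (fun j => B u v (e j)).
pose s := seminorm (B u) w.
have s0 : s != 0.
  by apply: contraNneq w0 => h; rewrite (psd_seminorm g_psd) -/s h expr0n.
pose e' (j : nat) := if j == d then (s^-1)%:C%C *: w else e j.
have sc : Num.conj (s^-1)%:C%C = (s^-1)%:C%C :> R[i].
  by apply/eqP; rewrite eq_complex /= oppr0 !eqxx.
have on' i j : (i < d.+1)%N -> (j < d.+1)%N -> B u (e' i) (e' j) = (i == j)%:R.
  rewrite ltnS leq_eqVlt => id; rewrite ltnS leq_eqVlt /e'.
  move: id => /orP[/eqP ->|id] /orP[/eqP ->|jd].
  - rewrite !eqxx (psdZl g_psd) (psdZr g_psd) sc (psd_seminorm g_psd) -/s.
    by rewrite -!rmorphM /= expr2 mulKf // mulVf.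
  - by rewrite eqxx (ltn_eqF jd) eq_sym (ltn_eqF jd) (psdZl g_psd) wj // mulr0.
  - by rewrite eqxx (ltn_eqF id) (psdZr g_psd) (psdC g_psd) wj // rmorph0 mulr0.
  - by rewrite (ltn_eqF id) (ltn_eqF jd) on.
exists (Block on') => v'; rewrite inE => /orP[/eqP ->|/ih [c hc]] /=.
  exists (fun j => if j == d then s%:C%C else B u v (e j)).
  rewrite big_ord_recr /= /e' eqxx.
  rewrite (eq_bigr (fun j : 'I_d => B u v (e j) *: e j)); last first.
    by move=> j _; rewrite (ltn_eqF (ltn_ord j)).
  rewrite scalerA -rmorphM /= mulfV // scale1r opprD addrA -/w subrr.
  exact: psd0l g_psd 0.
exists (fun j => if j == d then 0 else c j).
rewrite big_ord_recr /= eqxx scale0r addr0.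
rewrite (eq_bigr (fun j : 'I_d => c j *: e j)) // => j _.
by rewrite /e' (ltn_eqF (ltn_ord j)).
Qed.

Lemma block_norm n (b : block) (h : 'I_n -> 'I_(bdim b) -> R[i]) :
  seminorm (@amp_form n) (fun l => \sum_(j < bdim b) h l j *: bvec b j) ^+ 2
  = \sum_l \sum_(j < bdim b) modulus (h l j) ^+ 2.
Proof.
apply: (@complexI R); rewrite -(psd_seminorm (amp_form_psd n)) /amp_form rmorph_sum.
apply: eq_bigr => l _; rewrite form_suml rmorph_sum; apply: eq_bigr => j _ /=.
rewrite form_sumr (bigD1 j) //= bvecP // eqxx mulr1 big1 ?addr0.
  by rewrite -normCK normc_modulus rmorphXn.
move=> i ij; rewrite bvecP // eq_sym; move: ij; rewrite -val_eqE /= => /negbTE ->.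
by rewrite mulr0.
Qed.

(** The matrices (B x e_j e_i)_ij of an orthonormal family e form a completely
    contractive map: if c is the image of f, and p and q are the vectors of W
    with coordinates f and c, then ||c||^2 = sum_kl B x_kl p_l q_k, which is at
    most ||x|| ||p|| ||q|| = ||x|| ||f|| ||c||. *)
Lemma block_le n (x : 'M[X]_n) (b : block)
    (f : 'I_n -> 'I_(bdim b) -> R[i]) : (0 < n)%N ->
  \sum_k \sum_(i < bdim b) modulus (\sum_l \sum_(j < bdim b)
      B (x k l) (bvec b j) (bvec b i) * f l j) ^+ 2 <=
  mxnorm x ^+ 2 * \sum_l \sum_(j < bdim b) modulus (f l j) ^+ 2.
Proof.
move=> n0.
pose c k (i : 'I_(bdim b)) :=
  \sum_l \sum_(j < bdim b) B (x k l) (bvec b j) (bvec b i) * f l j.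
pose p l := \sum_(j < bdim b) f l j *: bvec b j.
pose q k := \sum_(i < bdim b) c k i *: bvec b i.
have cE : \sum_k \sum_(i < bdim b) modulus (c k i) ^+ 2
    = modulus (\sum_k \sum_l B (x k l) (p l) (q k)).
  apply: (@complexI R); rewrite -normc_modulus.
  have -> : \sum_k \sum_l B (x k l) (p l) (q k)
       = (\sum_k \sum_(i < bdim b) modulus (c k i) ^+ 2)%:C%C.
    rewrite rmorph_sum; apply: eq_bigr => k _ /=; rewrite rmorph_sum.
    under eq_bigr do rewrite form_sumr.
    rewrite exchange_big; apply: eq_bigr => i _ /=.
    rewrite -mulr_sumr rmorphXn /= -normc_modulus normCK mulrC; congr (_ * _).
    apply: eq_bigr => l _; rewrite form_suml; apply: eq_bigr => j _.
    by rewrite mulrC.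
  rewrite ger0_norm // lecR; apply: sumr_ge0 => k _; apply: sumr_ge0 => i _.
  exact: sqr_ge0.
have := B_le x p q n0.
rewrite -cE -[X in X <= _](block_norm c) -/q.
set t := seminorm _ q; set sp := seminorm _ p => h.
rewrite -[X in X <= _](block_norm c) -(block_norm f) -/q -/p -/t -/sp -exprMn.
have t0 : 0 <= t by exact: seminorm_ge0.
have sp0 : 0 <= mxnorm x * sp by rewrite mulr_ge0 ?opspace_mxnorm_ge0 ?seminorm_ge0.
rewrite ler_sqr ?nnegrE //.
have [->//|tn0] := eqVneq t 0.
have tp : 0 < t by rewrite lt_neqAle eq_sym tn0.
by rewrite -(ler_pM2r tp) -expr2.
Qed.

(** The disjoint union of the index sets of all orthonormal families: the
    operators below are block diagonal over this set. *)
Definition block_idx := {classic {b : block & 'I_(bdim b)}}.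

Definition in_block (b : block) (i : 'I_(bdim b)) : block_idx := existT _ b i.

Definition block_set (r : seq {classic block}) : {fset block_idx} :=
  [fset a in [seq in_block i | b <- r, i <- enum 'I_(bdim b)]]%fset.

Lemma block_set_sum (V : nmodType) (r : seq {classic block})
    (h : block_idx -> V) : uniq r ->
  \sum_(a <- block_set r) h a = \sum_(b <- r) \sum_(i < bdim b) h (in_block i).
Proof.
move=> ur; transitivity
  (\sum_(a <- [seq in_block i | b <- r, i <- enum 'I_(bdim b)]) h a).
  apply: perm_big; apply: uniq_perm; first exact: fset_uniq.
    apply: (@allpairs_uniq_dep {classic block} (fun b : {classic block} =>
      'I_(bdim b)) block_idx (fun b i => in_block i)) => //;
      first by move=> b _; exact: enum_uniq.
    by move=> [b i] [b' i'] _ _ /= E; exact: E.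
  by move=> a; rewrite inE.
rewrite big_allpairs_dep; apply: eq_bigr => b _.
by rewrite big_enum.
Qed.

Lemma mem_block_set (r : seq {classic block}) (b : block) (i : 'I_(bdim b)) :
  (b : {classic block}) \in r -> in_block i \in block_set r.
Proof.
move=> br; rewrite inE.
suff : in_block i \in [seq in_block i | b <- r, i <- enum 'I_(bdim b)] by [].
apply/(@allpairsPdep {classic block} (fun b : {classic block} =>
  'I_(bdim b)) block_idx (fun b i => in_block i)).
by exists b, i; split; rewrite ?mem_enum.
Qed.

Lemma block_set_cover (F : {fset block_idx}) :
  exists2 r, uniq r & fsubset F (block_set r).
Proof.
exists (undup [seq tag a : {classic block} | a <- F]); first exact: undup_uniq.
apply/fsubsetP => -[b i] aF; apply: mem_block_set.
by rewrite mem_undup;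
  exact: (@map_f block_idx {classic block} (fun a => tag a) _ _ aF).
Qed.

Definition blockfun (x : X) (f : block_idx -> R[i]) : block_idx -> R[i] :=
  fun a => \sum_(j < bdim (tag a)) B x (bvec (tag a) j)
    (bvec (tag a) (tagged a)) * f (in_block j).

(** Partial sums over unions of whole blocks dominate all partial sums, and are
    estimated block by block. *)
Lemma blockfun_psum n (x : 'M[X]_n) (f : 'I_n -> l2 R block_idx) F : (0 < n)%N ->
  \sum_k seminorm (psum F) (\sum_l blockfun (x k l) (f l)) ^+ 2 <=
  mxnorm x ^+ 2 * \sum_l seminorm (@l2dot R block_idx) (f l) ^+ 2.
Proof.
move=> n0; have [r ur Fr] := block_set_cover F.
apply: le_trans (_ : _ <=
  \sum_k \sum_(a <- block_set r)
    modulus ((\sum_l blockfun (x k l) (f l)) a) ^+ 2) _.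
  apply: ler_sum => k _; rewrite seminorm_psum; apply: psum_mono => // a;
    exact: sqr_ge0.
apply: le_trans (_ : _ <=
  mxnorm x ^+ 2 * \sum_l \sum_(a <- block_set r) modulus (f l a) ^+ 2) _;
  last first.
  rewrite ler_wpM2l ?sqr_ge0 //; apply: ler_sum => l _.
  rewrite -seminorm_psum ler_sqr ?nnegrE ?seminorm_ge0 //; exact: psum_le_l2.
under eq_bigr do rewrite (block_set_sum _ ur).
under [in leRHS]eq_bigr do rewrite (block_set_sum _ ur).
rewrite exchange_big [in leRHS]exchange_big mulr_sumr /=.
apply: ler_sum => b _.
apply: le_trans (block_le x (fun l j => f l (in_block j)) n0).
rewrite le_eqVlt; apply/orP; left; apply/eqP.
apply: eq_bigr => k _; apply: eq_bigr => i _; congr (modulus _ ^+ 2).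
by rewrite fct_sumE.
Qed.

Local Notation K := (l2_hilbert R block_idx).

Lemma blockfun_l2 x (f : K) : blockfun x (f : l2 R block_idx) \in @l2fun R block_idx.
Proof.
apply/asboolP; exists (mxnorm (const_mx x : 'M[X]_1) *
  seminorm (@l2dot R block_idx) f) => F.
have m0 : 0 <= mxnorm (const_mx x : 'M[X]_1) by exact: opspace_mxnorm_ge0.
rewrite -ler_sqr ?nnegrE ?mulr_ge0 ?seminorm_ge0 // exprMn.
by have := @blockfun_psum 1 (const_mx x) (fun=> f) F isT; rewrite !big_ord1 mxE.
Qed.

Definition blockop (x : X) : K -> K := fun f => L2 (blockfun_l2 x f).

Lemma blockopE x (f : K) (a : block_idx) : (blockop x f : l2 R block_idx) a =
  \sum_(j < bdim (tag a)) B x (bvec (tag a) j) (bvec (tag a) (tagged a)) *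
    (f : l2 R block_idx) (in_block j).
Proof. by []. Qed.

Lemma blockop_linearx : linear blockop.
Proof.
move=> a x y; apply/funext => f; apply: l2_inj => b.
rewrite -[RHS]/(a * (blockop x f : l2 R block_idx) b +
  (blockop y f : l2 R block_idx) b) !blockopE.
rewrite mulr_sumr -big_split; apply: eq_bigr => j _ /=.
by rewrite BxL mulrDl mulrA.
Qed.

Lemma blockop_linear x : linear (blockop x).
Proof.
move=> a f g; apply: l2_inj => b.
rewrite -[RHS]/(a * (blockop x f : l2 R block_idx) b +
  (blockop x g : l2 R block_idx) b) !blockopE.
rewrite mulr_sumr -big_split; apply: eq_bigr => j _ /=.
transitivity (B x (bvec (tag b) j) (bvec (tag b) (tagged b)) *
  (a * l2val f (in_block j) + l2val g (in_block j))); first by [].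
by ring.
Qed.

Lemma blockop_unital : blockop u = id.
Proof.
apply/funext => f; apply: l2_inj => -[b i]; rewrite blockopE /=.
rewrite (bigD1 i) //= bvecP // eqxx mul1r big1 ?addr0 // => j ji.
by rewrite bvecP //; move: ji; rewrite -val_eqE /= => /negbTE ->; rewrite mul0r.
Qed.

Lemma blockop_mxapply n (x : 'M[X]_n) (f : 'I_n -> K) k :
  l2val (mxapply (map_mx blockop x) f k) = \sum_l blockfun (x k l) (l2val (f l)).
Proof.
apply: (big_ind2 (fun (a : K) (c : block_idx -> R[i]) => l2val a = c)) => //.
  by move=> a1 c1 a2 c2 <- <-.
by move=> l _; rewrite mxE.
Qed.

Lemma blockop_contract n (x : 'M[X]_n) (f : 'I_n -> K) : (0 < n)%N ->
  l2norm (mxapply (map_mx blockop x) f) <= mxnorm x * l2norm f.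
Proof.
move=> n0; have m0 : 0 <= mxnorm x by exact: opspace_mxnorm_ge0.
rewrite -ler_sqr ?nnegrE ?mulr_ge0 ?l2normE ?seminorm_ge0 // -!l2normE exprMn
  !l2norm_sqr.
apply: l2_sum_le => F; apply: le_trans (blockfun_psum x f F n0).
rewrite le_eqVlt; apply/orP; left; apply/eqP; apply: eq_bigr => k _.
congr (seminorm _ _ ^+ 2).
by rewrite blockop_mxapply.
Qed.

Lemma blockop_bounded x : bounded_operators (blockop x).
Proof.
split; first exact: blockop_linear.
pose S : {linear K -> K} :=
  HB.pack (blockop x) (GRing.isLinear.Build _ _ _ _ _ (blockop_linear x)).
apply: (@bounded_linear_continuous _ _ _ S).
apply/linear_boundedP.
pose M := mxnorm (const_mx x : 'M[X]_1).
have h (f : K) : `|blockop x f| <= M%:C%C * `|f|.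
  rewrite !norm_seminorm -rmorphM lecR.
  have := @blockop_contract 1 (const_mx x) (fun=> f) isT.
  by rewrite !l2normE /seminorm /dotn !big_ord1 /mxapply big_ord1 !mxE.
exists M%:C%C; split; first by rewrite complex_real.
by move=> r Mr f; apply: le_trans (h f) _; rewrite ler_wpM2r // ltW.
Qed.

Lemma blockop_opnorm_le n (x : 'M[X]_n) : (0 < n)%N ->
  opnorm (map_mx blockop x) <= mxnorm x.
Proof.
move=> n0; apply: opnorm_le => f f1; apply: le_trans (blockop_contract x f n0) _.
by rewrite -[leRHS]mulr1 ler_wpM2l // opspace_mxnorm_ge0.
Qed.

Lemma block_embed (b : block) (c : 'I_(bdim b) -> R[i]) : exists2 f : K,
  forall i, l2val f (in_block i) = c i &
  seminorm (@hdot R K) f ^+ 2 <= \sum_i modulus (c i) ^+ 2.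
Proof.
pose f (a : block_idx) := \sum_i c i * (a == in_block i)%:R.
have mkE (i j : 'I_(bdim b)) : (in_block i == in_block j) = (i == j).
  apply/eqP/eqP => [|-> //] E.
  by apply: val_inj; exact: (congr1 (fun a : block_idx => tagged a : nat) E).
have fE i : f (in_block i) = c i.
  rewrite /f (bigD1 i) //= eqxx mulr1 big1 ?addr0 // => j ji.
  by rewrite mkE eq_sym (negbTE ji) mulr0.
pose G := block_set [:: b : {classic block}].
have f0 a : a \notin G -> f a = 0.
  move=> aG; rewrite /f big1 // => i _.
  have [ai|_] := eqVneq a (in_block i); last by rewrite mulr0.
  by move: aG; rewrite ai mem_block_set // inE.
have fl2 : f \in @l2fun R block_idx.
  by apply/asboolP; exists (seminorm (psum G) f) => F; exact: psum_support.
exists (L2 fl2 : K) => //.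
have -> : \sum_i modulus (c i) ^+ 2 = seminorm (psum G) f ^+ 2.
  rewrite seminorm_psum block_set_sum // big_seq1.
  by apply: eq_bigr => i _; rewrite fE.
rewrite ler_sqr ?nnegrE ?seminorm_ge0 //.
by apply: l2_le => [|F]; [exact: seminorm_ge0|exact: psum_support].
Qed.

(** Choose a family that spans all xi_l and zeta_k up to null vectors.  In its
    coordinates, which are finitely supported elements of K, the left-hand side
    is the inner product of x applied to the first tuple with the second. *)
Lemma form_le_blockop n (x : 'M[X]_n) (xi zeta : 'I_n -> W) : (0 < n)%N ->
  modulus (\sum_k \sum_l B (x k l) (xi l) (zeta k)) <=
  opnorm (map_mx blockop x) * seminorm (@amp_form n) xi *
    seminorm (@amp_form n) zeta.
Proof.
move=> n0.
have [b hb] := gram_schmidt (codom xi ++ codom zeta).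
have /choice[c hc] l : exists c : nat -> R[i],
    let w := xi l - \sum_(j < bdim b) c j *: bvec b j in B u w w = 0.
  by apply: hb; rewrite mem_cat codom_f.
have /choice[d hd] k : exists c : nat -> R[i],
    let w := zeta k - \sum_(j < bdim b) c j *: bvec b j in B u w w = 0.
  by apply: hb; rewrite mem_cat codom_f orbT.
rewrite /= in hc hd.
pose xi' l := \sum_(j < bdim b) c l j *: bvec b j.
pose zeta' k := \sum_(j < bdim b) d k j *: bvec b j.
have -> : \sum_k \sum_l B (x k l) (xi l) (zeta k) =
    \sum_k \sum_l B (x k l) (xi' l) (zeta' k).
  apply: eq_bigr => k _; apply: eq_bigr => l _.
  by rewrite (form_eql _ _ (hc l)) (form_eqr _ _ (hd k)).
have normE (v v' : 'I_n -> W) :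
    (forall l, B u (v l - v' l) (v l - v' l) = 0) ->
    seminorm (@amp_form n) v = seminorm (@amp_form n) v'.
  move=> vv'; rewrite /seminorm /amp_form; congr (Num.sqrt (Re _)).
  by apply: eq_bigr => l _; rewrite (form_eql _ _ (vv' l)) (form_eqr _ _ (vv' l)).
rewrite (normE _ _ hc) (normE _ _ hd).
have hf0 l : exists f : K, (forall i : 'I_(bdim b), l2val f (in_block i) = c l i) /\
    seminorm (@hdot R K) f ^+ 2 <= \sum_(i < bdim b) modulus (c l i) ^+ 2.
  by have [f f1 f2] := block_embed (fun i : 'I_(bdim b) => c l i); exists f.
have [f hf] := choice hf0.
have hh0 l : exists f : K, (forall i : 'I_(bdim b), l2val f (in_block i) = d l i) /\
    seminorm (@hdot R K) f ^+ 2 <= \sum_(i < bdim b) modulus (d l i) ^+ 2.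
  by have [g g1 g2] := block_embed (fun i : 'I_(bdim b) => d l i); exists g.
have [h hh] := choice hh0.
have embed_le (e : 'I_n -> nat -> R[i]) (g : 'I_n -> K) :
    (forall l, seminorm (@hdot R K) (g l) ^+ 2 <=
      \sum_(i < bdim b) modulus (e l i) ^+ 2) ->
    l2norm g <= seminorm (@amp_form n) (fun l =>
      \sum_(j < bdim b) e l j *: bvec b j).
  move=> hg; rewrite -ler_sqr ?nnegrE ?l2normE ?seminorm_ge0 //.
  rewrite -l2normE (block_norm (fun l j => e l j)) (l2norm_sqr g).
  by apply: ler_sum => l _.
pose y := mxapply (map_mx blockop x) f.
have yE k (i : 'I_(bdim b)) : l2val (y k) (in_block i) =
  \sum_l \sum_(j < bdim b) B (x k l) (bvec b j) (bvec b i) * c l j.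
  rewrite /y blockop_mxapply fct_sumE; apply: eq_bigr => l _.
  by apply: eq_bigr => j _ /=; rewrite (hf l).1.
pose G := block_set [:: b : {classic block}].
have -> : \sum_k \sum_l B (x k l) (xi' l) (zeta' k) =
  \sum_k psum G (l2val (y k)) (l2val (h k)).
  apply: eq_bigr => k _; rewrite /psum block_set_sum // big_seq1.
  under eq_bigr do rewrite form_sumr.
  rewrite exchange_big; apply: eq_bigr => i _ /=.
  rewrite -mulr_sumr yE (hh k).1 mulrC; congr (_ * _).
  apply: eq_bigr => l _; rewrite form_suml; apply: eq_bigr => j _.
  by rewrite mulrC.
have psdG := @psd_form_sum R _ _ 'I_n (@psum_psd R block_idx G).
have psum_le (g : 'I_n -> K) :
  seminorm (fun p q : 'I_n -> (block_idx -> R[i]) => \sum_k psum G (p k) (q k))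
    (fun k => l2val (g k)) <= l2norm g.
  rewrite -ler_sqr ?nnegrE ?l2normE ?seminorm_ge0 // -l2normE l2norm_sqr.
  rewrite seminorm_form_sum; last exact: psum_psd.
  apply: ler_sum => k _; rewrite ler_sqr ?nnegrE ?seminorm_ge0 //; exact: psum_le_l2.
apply: le_trans (seminorm_CS psdG (fun k => l2val (y k)) (fun k => l2val (h k))) _.
apply: ler_pM; rewrite ?seminorm_ge0 //.
  apply: le_trans (psum_le y) _; apply: le_trans (opnorm_mxapply _ _) _.
    by move=> i j; rewrite mxE; exact: blockop_bounded.
  rewrite ler_wpM2l ?opnorm_ge0 //.
    by move=> i j; rewrite mxE; exact: blockop_bounded.
  by apply: embed_le => l; exact: (hf l).2.
apply: le_trans (psum_le h) _.
by apply: embed_le => l; exact: (hh l).2.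
Qed.

(** The direct sum of the compressions of B to its finite orthonormal
    families. *)
Theorem unital_compression :
  exists (K : hilbertType R) (S : {linear X -> (K -> K)}),
  [/\ S u = id, forall x, bounded_operators (S x),
      forall n (x : 'M[X]_n), (0 < n)%N -> opnorm (map_mx S x) <= mxnorm x &
      forall n (x : 'M[X]_n) (xi zeta : 'I_n -> W), (0 < n)%N ->
        modulus (\sum_k \sum_l B (x k l) (xi l) (zeta k)) <=
        opnorm (map_mx S x) * seminorm (@amp_form n) xi *
          seminorm (@amp_form n) zeta].
Proof.
exists K; pose S : {linear X -> (K -> K)} :=
  HB.pack blockop (GRing.isLinear.Build _ _ _ _ _ blockop_linearx).
exists S; split.
- exact: blockop_unital.
- exact: blockop_bounded.
- by move=> n x n0; exact: blockop_opnorm_le.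
- by move=> n x xi zeta n0; exact: form_le_blockop.
Qed.

End Dilation.

(** * Sequences along which u is asymptotically isometric *)

Section Ultraproduct.
Variables (R : realType) (X : operatorSpace R) (H : hilbertType R).
Variable T : {linear X -> (H -> H)}.
Hypothesis cT : complete_isometry (@mxnorm R X) T.
Variable u : X.
Hypothesis u1 : `|u| <= 1.
Variable U : set_system nat.
Hypothesis UU : UltraFilter U.

Local Notation dot := (@hdot R H).
Local Notation nrm := (seminorm dot).

Let PU : ProperFilter U := ultra_proper.

Lemma rep_contract v : nrm (T u v) <= nrm v.
Proof.
apply: le_trans (rep_le cT u v) _; rewrite -[leRHS]mul1r ler_wpM2r ?seminorm_ge0 //.
by rewrite -lecR -ge0_Re.
Qed.

(** The form of 1 - u^*u. *)
Definition defect (v w : H) : R[i] := dot v w - dot (T u v) (T u w).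

Lemma defect_psd : psd_form defect.
Proof.
have hp := @hdot_psd R H; split.
- move=> v w z; rewrite /defect (rep_addv cT) !(psdDl hp); ring.
- move=> c v w; rewrite /defect (rep_scalev cT) !(psdZl hp); ring.
- by move=> v w; rewrite /defect rmorphB /= -!(psdC hp).
- move=> v; rewrite /defect subr_ge0 !(psd_seminorm hp) lecR.
  by rewrite ler_sqr ?nnegrE ?seminorm_ge0 // rep_contract.
Qed.

Definition asym_isometric : {pred nat -> H} := fun p =>
  `[< (exists M : R, forall m, nrm (p m) <= M) /\
      (seminorm defect (p m) @[m --> U] --> (0 : R)) >].

Lemma asym_isometric_submod_closed : submod_closed asym_isometric.
Proof.
have hp := @hdot_psd R H.
split.
  apply/asboolP; split.
    by exists 0 => m; rewrite (seminorm0 hp).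
  under eq_fun => m do rewrite (seminorm0 defect_psd).
  exact: cvg_cst.
move=> c p q /asboolP[[M hM] p0] /asboolP[[N hN] q0]; apply/asboolP; split.
  exists (modulus c * M + N) => m.
  apply: le_trans (seminormD hp _ _) _.
  by rewrite lerD // (seminormZ hp) ler_wpM2l ?modulus_ge0.
apply: (squeeze_cvgr (f := fun=> 0)
  (h := fun m => modulus c * seminorm defect (p m) + seminorm defect (q m))).
- apply: nearW => m; rewrite seminorm_ge0 /=.
  by rewrite -(seminormZ defect_psd); exact: seminormD defect_psd _ _.
- exact: cvg_cst.
- by rewrite -[X in _ --> X]addr0 -{1}(mulr0 (modulus c)); apply: cvgD => //;
  apply: cvgMr.
Qed.
HB.instance Definition _ :=
  GRing.isSubmodClosed.Build R[i] (nat -> H)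
    asym_isometric asym_isometric_submod_closed.

Record asym_seq := AsymSeq { asym_val :> nat -> H;
  asym_valP : asym_val \in asym_isometric }.
HB.instance Definition _ := [isSub for asym_val].
HB.instance Definition _ := [Choice of asym_seq by <:].
HB.instance Definition _ := [SubChoice_isSubLmodule of asym_seq by <:].

Lemma asym_seqP (p : asym_seq) : (exists M : R, forall m, nrm (p m) <= M) /\
  (seminorm defect (p m) @[m --> U] --> (0 : R)).
Proof. by have /asboolP := asym_valP p. Qed.

Definition rep_form (x : X) (p q : asym_seq) : R[i] :=
  ulim U (fun m => dot (T x (p m)) (T u (q m))).

Lemma cbounded_rep (x : X) (p q : asym_seq) : cbounded (fun m =>
  dot (T x (p m)) (T u (q m))).
Proof.
have [[M hM] _] := asym_seqP p; have [[N hN] _] := asym_seqP q.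
exists (Re `|x| * M * N) => m; apply: le_trans (seminorm_CS (@hdot_psd R H) _ _) _.
have x0 : 0 <= Re `|x| by rewrite mxnorm1; exact: opspace_mxnorm_ge0.
apply: ler_pM; rewrite ?seminorm_ge0 //.
  by apply: le_trans (rep_le cT _ _) _; rewrite ler_wpM2l.
exact: le_trans (rep_contract _) _.
Qed.

Lemma cbounded_dot (p q : asym_seq) : cbounded (fun m => dot (p m) (q m)).
Proof.
have [[M hM] _] := asym_seqP p; have [[N hN] _] := asym_seqP q.
exists (M * N) => m; apply: le_trans (seminorm_CS (@hdot_psd R H) _ _) _.
by apply: ler_pM; rewrite ?seminorm_ge0.
Qed.

Lemma rep_form_linx a x y p q : rep_form (a *: x + y) p q =
  a * rep_form x p q + rep_form y p q.
Proof.
rewrite /rep_form -(ulimZ UU a (cbounded_rep x p q))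
  -(ulimD UU (cboundedZ a (cbounded_rep x p q)) (cbounded_rep y p q)).
congr ulim; apply/funext => m.
by rewrite rep_addx rep_scalex (psdDl (@hdot_psd R H)) (psdZl (@hdot_psd R H)).
Qed.

Lemma rep_form_linl x a p p' q : rep_form x (a *: p + p') q =
  a * rep_form x p q + rep_form x p' q.
Proof.
rewrite /rep_form -(ulimZ UU a (cbounded_rep x p q))
  -(ulimD UU (cboundedZ a (cbounded_rep x p q)) (cbounded_rep x p' q)).
congr ulim; apply/funext => m.
rewrite -[(a *: p + p' : asym_seq) m]/(a *: p m + p' m).
by rewrite (rep_linear cT) (psdDl (@hdot_psd R H)) (psdZl (@hdot_psd R H)).
Qed.

Lemma rep_form_linr x a p q q' :
  rep_form x p (a *: q + q') = Num.conj a * rep_form x p q + rep_form x p q'.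
Proof.
rewrite /rep_form -(ulimZ UU _ (cbounded_rep x p q))
  -(ulimD UU (cboundedZ _ (cbounded_rep x p q)) (cbounded_rep x p q')).
congr ulim; apply/funext => m.
rewrite -[(a *: q + q' : asym_seq) m]/(a *: q m + q' m).
by rewrite (rep_linear cT) (psdDr (@hdot_psd R H)) (psdZr (@hdot_psd R H)).
Qed.

(** The difference of the two sides is the limit of the form of 1 - u^*u, which
    vanishes by the Cauchy--Schwarz inequality for that form. *)
Lemma rep_form_unitE p q : rep_form u p q = ulim U (fun m => dot (p m) (q m)).
Proof.
have [_ p0] := asym_seqP p; have [_ q0] := asym_seqP q.
have d0 : ulim U (fun m => defect (p m) (q m)) = 0.
  apply: (ulim_eq0 UU (a := fun m => seminorm defect (p m) * seminorm defect (q m))).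
    by rewrite -[X in _ --> X](mulr0 0); apply: cvgM.
  by move=> m; exact: seminorm_CS defect_psd _ _.
have bd : cbounded (fun m => defect (p m) (q m)).
  have := cboundedD (cbounded_dot p q) (cboundedZ (-1) (cbounded_rep u p q)).
  by congr cbounded; apply/funext => m; rewrite mulN1r.
rewrite -[LHS]add0r -d0 /rep_form -(ulimD UU bd (cbounded_rep u p q)).
by congr ulim; apply/funext => m; rewrite /defect subrK.
Qed.

Lemma rep_form_psd : psd_form (rep_form u).
Proof.
have hp := @hdot_psd R H; split.
- by move=> p q r; have := rep_form_linl u 1 p q r; rewrite scale1r mul1r.
- move=> c p q; have := rep_form_linl u c p 0 q; rewrite addr0 => ->.
  by have := rep_form_linl u (-1) 0 0 q;
    rewrite scaleN1r oppr0 addr0 mulN1r addNr => ->; rewrite addr0.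
- move=> p q; rewrite !rep_form_unitE -(ulim_conj UU (cbounded_dot q p)).
  by congr ulim; apply/funext => m; exact: psdC hp _ _.
- move=> p; rewrite rep_form_unitE; apply: (ulim_ge0 UU (cbounded_dot p p)) => m.
  exact: psd_ge0 hp _.
Qed.

Lemma rep_form_sum n (x : 'M[X]_n) (p q : 'I_n -> asym_seq) :
  \sum_k \sum_l rep_form (x k l) (p l) (q k) =
  ulim U (fun m => dotn (act T x (fun i => p i m)) (fun i => T u (q i m))).
Proof.
under eq_bigr do rewrite -(ulim_sum UU _ (fun l => cbounded_rep _ (p l) _)).
rewrite -(ulim_sum UU) => [|k]; last by apply: cbounded_sum => l;
  exact: cbounded_rep.
congr ulim; apply/funext => m; apply: eq_bigr => k _.
by rewrite act_sum (psd_suml (@hdot_psd R H)).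
Qed.

Lemma amp_form_ulim n (p q : 'I_n -> asym_seq) :
  amp_form u rep_form p q = ulim U (fun m => dotn (fun i => p i m) (fun i => q i m)).
Proof.
rewrite /amp_form; under eq_bigr do rewrite rep_form_unitE.
by rewrite -(ulim_sum UU) // => k; exact: cbounded_dot.
Qed.

Lemma rep_form_le n (x : 'M[X]_n) (p q : 'I_n -> asym_seq) : (0 < n)%N ->
  modulus (\sum_k \sum_l rep_form (x k l) (p l) (q k)) <=
  mxnorm x * seminorm (@amp_form R X u asym_seq rep_form n) p *
    seminorm (@amp_form R X u asym_seq rep_form n) q.
Proof.
move=> n0; rewrite rep_form_sum.
have dp := @dotn_psd R H n.
have ap : psd_form (@amp_form R X u asym_seq rep_form n) :=
  psd_form_sum _ rep_form_psd.
have m0 : 0 <= mxnorm x := opspace_mxnorm_ge0 x n0.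
have bpq (r s : 'I_n -> asym_seq) : cbounded (fun m =>
  dotn (fun i => r i m) (fun i => s i m)).
  by apply: cbounded_sum => i; exact: cbounded_dot.
rewrite -ler_sqr ?nnegrE ?modulus_ge0 ?mulr_ge0 ?seminorm_ge0 // -lecR rmorphXn
  /= -normc_modulus.
have E (a b c : R) : ((a * b * c) ^+ 2)%:C%C =
  (a ^+ 2)%:C%C * (b ^+ 2)%:C%C * (c ^+ 2)%:C%C :> R[i].
  by rewrite -!rmorphM -!exprMn.
rewrite E -!(psd_seminorm ap) !amp_form_ulim.
rewrite -(ulimZ UU _ (bpq p p)).
apply: (ulim_CS UU) => //.
- apply: cbounded_sum => k;
  under eq_fun do rewrite act_sum (psd_suml (@hdot_psd R H)).
  by apply: cbounded_sum => l; exact: cbounded_rep.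
- exact: cboundedZ.
- move=> m; rewrite normc_modulus !(psd_seminorm dp) -!rmorphM -rmorphXn lecR /=
  -!exprMn.
  rewrite ler_sqr ?nnegrE ?modulus_ge0 ?mulr_ge0 ?seminorm_ge0 //.
  apply: le_trans (seminorm_CS dp _ _) _.
  apply: ler_pM; rewrite ?seminorm_ge0 //; first exact: act_le.
  rewrite -ler_sqr ?nnegrE ?seminorm_ge0 // !(seminorm_form_sum _ (@hdot_psd R H)).
  apply: ler_sum => i _; rewrite ler_sqr ?nnegrE ?seminorm_ge0 //;
    exact: rep_contract.
- by move=> m; rewrite mulr_ge0 ?lecR ?sqr_ge0 ?(psd_ge0 dp).
- by move=> m; exact: psd_ge0 dp _.
Qed.

Lemma rep_form_unital : unital_form u rep_form.
Proof.
split.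
- exact: rep_form_linx.
- exact: rep_form_linl.
- exact: rep_form_linr.
- exact: rep_form_psd.
- exact: rep_form_le.
Qed.

Section NormingVectors.
Hypothesis Uoo : \oo `<=` U.
Hypothesis pencil : forall n (x : 'M[X]_n), (0 < n)%N ->
  Num.sqrt (1 + mxnorm x) <=
  \big[Num.max/0]_(k < 4) mxnorm (diag_amp u n + scale_entries ('i%C ^+ k) x).

Lemma act_scale n c (x : 'M[X]_n) v : act T (scale_entries c x) v = c *: act T x v.
Proof.
apply/funext => i; rewrite -[RHS]/(c *: act T x v i) !act_sum scaler_sumr.
by apply: eq_bigr => j _; rewrite mxE rep_scalex.
Qed.

Lemma mxnorm_scale_ge n (t : R) (x : 'M[X]_n) : (0 < n)%N -> 0 < t ->
  t * mxnorm x <= mxnorm (scale_entries t%:C%C x).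
Proof.
move=> n0 t0; rewrite -ler_pdivlMl //; apply: (mxnorm_le cT) => // v v1.
rewrite ler_pdivlMl //.
have at1 : modulus t%:C%C = t.
  by rewrite modulus_real // ltW.
have := act_le cT (scale_entries t%:C%C x) v n0.
rewrite act_scale (seminormZ (@dotn_psd R H n)) at1 => h; apply: le_trans h _.
rewrite -[leRHS]mulr1 ler_wpM2l //; exact: opspace_mxnorm_ge0.
Qed.

(** Some k has ||u + i^k t x||^2 > 1 + t ||x|| - t^2, hence there is a v with
    ||v|| <= 1 and
    1 + t ||x|| - t^2 < ||u v||^2 + 2 t |<x v, u v>| + t^2 ||x v||^2.
    Both estimates follow, the first one by |<x v, u v>| <= ||x||, the second
    one by ||u v|| <= 1. *)
Lemma almost_norming n (x : 'M[X]_n) (t : R) : (0 < n)%N -> 0 < t -> t <= 1 ->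
  exists v : 'I_n -> H, [/\ seminorm (@dotn R H n) v <= 1,
    seminorm (@dotn R H n) v ^+ 2 - seminorm (@dotn R H n) (fun i => T u (v i)) ^+ 2
       <= t * (1 + mxnorm x + mxnorm x ^+ 2) &
    mxnorm x / 2 <= modulus (dotn (act T x v) (fun i => T u (v i)))
       + t * ((1 + mxnorm x ^+ 2) / 2)].
Proof.
move=> n0 t0 t1; set a := mxnorm x.
have dp := @dotn_psd R H n.
have a0 : 0 <= a by exact: opspace_mxnorm_ge0.
pose xt := scale_entries t%:C%C x.
have xta : t * a <= mxnorm xt by exact: mxnorm_scale_ge.
pose s := Num.sqrt (1 + t * a - t ^+ 2).
have pos : 0 <= 1 + t * a - t ^+ 2.
  have : 0 <= t * a by rewrite mulr_ge0 // ltW.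
  have : t ^+ 2 <= 1 by rewrite expr_le1 // ltW.
  by lra.
have [k hk] : exists k : 'I_4, s <
  mxnorm (diag_amp u n + scale_entries ('i%C ^+ k) xt).
  apply: contrapT => /forallNP hn.
  have := pencil xt n0; apply/negP; rewrite -ltNge.
  apply: le_lt_trans (_ : _ <= s) _.
    apply: bigmax_le; first exact: sqrtr_ge0.
    by move=> k _; rewrite leNgt; apply/negP; exact: hn.
  rewrite ltr_sqrt; have := exprn_gt0 2 t0; lra.
have [v v1 hv] := lt_mxnorm cT n0 hk.
move: hv; rewrite act_pencil act_scale scalerA.
set y := act T x v; set w := fun i => T u (v i).
set c := 'i%C ^+ k * t%:C%C.
have cabs : modulus c = t.
  by rewrite /c modulusM modulus_iX mul1r modulus_real // ltW.
rewrite -ltr_sqr ?nnegrE ?seminorm_ge0 ?sqrtr_ge0 // sqr_sqrtr //.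
rewrite (seminorm_sqrD dp) (seminormZ dp) cabs (psdZr dp) exprMn.
have ya : seminorm (@dotn R H n) y <= a.
  apply: le_trans (act_le cT x v n0) _.
  by rewrite -[leRHS]mulr1 ler_wpM2l.
have ya2 : seminorm (@dotn R H n) y ^+ 2 <=
  a ^+ 2 by rewrite ler_sqr ?nnegrE ?seminorm_ge0.
have v2 : seminorm (@dotn R H n) v ^+ 2 <= 1 by rewrite expr_le1 // seminorm_ge0.
have wv : seminorm (@dotn R H n) w ^+ 2 <= seminorm (@dotn R H n) v ^+ 2.
  rewrite !(seminorm_form_sum _ (@hdot_psd R H)).
  by apply: ler_sum => i _; rewrite ler_sqr ?nnegrE ?seminorm_ge0 //;
    exact: rep_contract.
have sb : modulus (dotn y w) <= a.
  apply: le_trans (seminorm_CS dp _ _) _; rewrite -[leRHS]mulr1.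
  apply: ler_pM; rewrite ?seminorm_ge0 //.
  by rewrite -(@expr_le1 _ 2) ?seminorm_ge0 //; apply: le_trans wv v2.
have rb : Re (Num.conj c * dotn w y) <= t * modulus (dotn y w).
  apply: le_trans (ler_norm _) _; apply: le_trans (Re_le_modulus _) _.
  rewrite modulusM (psdC dp) le_eqVlt; apply/orP; left; apply/eqP.
  by rewrite !modulus_conj cabs.
set sy := seminorm _ y ^+ 2 in ya2 *; set sw := seminorm _ w ^+ 2 in wv *.
set sv := seminorm _ v ^+ 2 in wv v2 *; set r := Re _ in rb *;
  set d := modulus _ in sb rb *.
move=> h; have h2 : t ^+ 2 * sy <= t ^+ 2 * a ^+ 2 by rewrite ler_wpM2l // sqr_ge0.
have t2 : t ^+ 2 <= t by rewrite expr2 -[leRHS]mulr1 ler_wpM2l // ltW.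
exists v; split => //.
  rewrite -/w -/sw -/sv.
  have : t * d <= t * a by rewrite ler_wpM2l // ltW.
  have : t ^+ 2 * a ^+ 2 <= t * a ^+ 2 by rewrite ler_wpM2r // sqr_ge0.
  rewrite mulrDr mulrDr mulr1; lra.
rewrite -/y -/w -/d -(ler_pM2l t0) mulrDr.
have -> : t * (t * ((1 + a ^+ 2) / 2)) = (t ^+ 2 + t ^+ 2 * a ^+ 2) / 2 by field.
rewrite mulrA; lra.
Qed.

(** Apply [almost_norming] with t = 1 / (m + 1) and collect the vectors. *)
Lemma norming_asym_seq n (x : 'M[X]_n) : (0 < n)%N ->
  exists2 xi : 'I_n -> asym_seq, seminorm (@amp_form R X u asym_seq rep_form n) xi <= 1 &
    mxnorm x / 2 <= modulus (\sum_k \sum_l rep_form (x k l) (xi l) (xi k)).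
Proof.
move=> n0.
have dp := @dotn_psd R H n.
pose t (m : nat) : R := m.+1%:R^-1.
have t0 m : 0 < t m by rewrite invr_gt0.
have t1 m : t m <= 1 by rewrite invf_le1 // ler1n.
have tU : t m @[m --> U] --> (0 : R).
  by apply: cvg_trans (@cvg_harmonic R) => A hA; apply: Uoo.
have [v hv] := choice (fun m => almost_norming x n0 (t0 m) (t1 m)).
have vw i : (fun m => v m i) \in asym_isometric.
  apply/asboolP; split.
    exists 1 => m; have [h _ _] := hv m.
    rewrite -ler_sqr ?nnegrE ?seminorm_ge0 // expr1n.
    apply: le_trans (_ : seminorm (@dotn R H n) (v m) ^+ 2 <= _);
      last by rewrite expr_le1 // seminorm_ge0.
    rewrite (seminorm_form_sum _ (@hdot_psd R H)) (bigD1 i) //= lerDl.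
    by apply: sumr_ge0 => j _; exact: sqr_ge0.
  pose C := 1 + mxnorm x + mxnorm x ^+ 2.
  apply: (squeeze_cvgr (f := fun=> 0) (h := fun m => Num.sqrt (t m * C))).
  - apply: nearW => m; rewrite seminorm_ge0 /=; apply: ler_wsqrtr.
    have [_ h _] := hv m; apply: le_trans h.
    rewrite !(seminorm_form_sum _ (@hdot_psd R H)) -sumrB (bigD1 i) //=.
    rewrite /defect raddfB /= !(psd_seminorm (@hdot_psd R H)) lerDl.
    apply: sumr_ge0 => j _; rewrite subr_ge0 ler_sqr ?nnegrE ?seminorm_ge0 //.
    exact: rep_contract.
  - exact: cvg_cst.
  - rewrite -[X in _ --> X]sqrtr0; apply: continuous_cvg;
    first exact: sqrt_continuous.
    by rewrite -[X in _ --> X](mul0r C); apply: cvgMl.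
pose xi i : asym_seq := AsymSeq (vw i).
exists xi.
  have ap : psd_form (@amp_form R X u asym_seq rep_form n) :=
    psd_form_sum _ rep_form_psd.
  rewrite -(@expr_le1 _ 2) ?seminorm_ge0 //.
  rewrite -lecR -(psd_seminorm ap) amp_form_ulim -subr_ge0.
  have bd : cbounded (fun m => dotn (v m) (v m)) by apply: cbounded_sum => i;
    exact: (cbounded_dot (xi i) (xi i)).
  rewrite -[X in X - _](ulim_cst UU) -mulN1r -(ulimZ UU _ bd).
  have b1 : cbounded (fun _ : nat => 1%:C%C : R[i]) by exists (modulus 1%:C%C) => m.
  rewrite -(ulimD UU b1 (cboundedZ _ bd)).
  apply: (ulim_ge0 UU (cboundedD b1 (cboundedZ _ bd))) => m.
  rewrite mulN1r subr_ge0 (psd_seminorm dp) lecR.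
  by rewrite expr_le1 ?seminorm_ge0 //; have [] := hv m.
rewrite rep_form_sum.
apply: (ulim_modulus_ge UU (a := fun m => t m * ((1 + mxnorm x ^+ 2) / 2))).
- apply: cbounded_sum => k;
  under eq_fun do rewrite act_sum (psd_suml (@hdot_psd R H)).
  by apply: cbounded_sum => l; exact: (cbounded_rep _ (xi l) (xi k)).
- by rewrite -[X in _ --> X](mul0r ((1 + mxnorm x ^+ 2) / 2)); apply: cvgMl.
- by move=> m; have [] := hv m.
Qed.

End NormingVectors.
End Ultraproduct.

Theorem norming_form (R : realType) (X : operatorSpace R) (u : X) : `|u| <= 1 ->
  (forall n (x : 'M[X]_n), (0 < n)%N ->
    Num.sqrt (1 + mxnorm x) <=
    \big[Num.max/0]_(k < 4) mxnorm (diag_amp u n + scale_entries ('i%C ^+ k) x)) ->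
  exists (W : lmodType R[i]) (B : X -> W -> W -> R[i]), unital_form u B /\
    forall n (x : 'M[X]_n), (0 < n)%N ->
    exists2 xi : 'I_n -> W, seminorm (@amp_form R X u W B n) xi <= 1 &
      mxnorm x / 2 <= modulus (\sum_k \sum_l B (x k l) (xi l) (xi k)).
Proof.
move=> u1 pencil; have [H [T cT]] := opspace_repr X.
have [U [UU Uoo]] := ultraFilterLemma (@eventually_filter).
eexists; exists (rep_form (T := T) (u := u) (U := U)); split;
  first exact: (rep_form_unital cT u1 UU).
by move=> n x n0; exact: norming_asym_seq.
Qed.

(** * The norm of x and the numerical range of a corner *)

Section Corner.
Variables (R : realType) (X : operatorSpace R).

(** Pairings with a corner involve two complementary halves of a vector; this
    makes up for the factor 1/2 between numerical range and norm. *)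
Definition corner n (x : 'M[X]_n) : 'M[X]_(n + n) := block_mx 0 x 0 0.

Lemma corner_ul n (x : 'M[X]_n) k l : corner x (lshift n k) (lshift n l) = 0.
Proof. by rewrite block_mxEul mxE. Qed.
Lemma corner_ur n (x : 'M[X]_n) k l : corner x (lshift n k) (rshift n l) = x k l.
Proof. by rewrite block_mxEur. Qed.
Lemma corner_d n (x : 'M[X]_n) k l : corner x (rshift n k) l = 0.
Proof.
case: (split_ordP l) => j ->; first by rewrite block_mxEdl mxE.
by rewrite block_mxEdr mxE.
Qed.

Lemma mxnorm_corner n (x : 'M[X]_n) : (0 < n)%N -> mxnorm x <= mxnorm (corner x).
Proof.
move=> n0; have n2 : (0 < n + n)%N by rewrite addn_gt0 n0.
have [H [T cT]] := opspace_repr X.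
have hp := @hdot_psd R H.
apply: (mxnorm_le cT) => // v v1.
pose w (i : 'I_(n + n)) : H := if fintype.split i is inr j then v j else 0.
have wl j : w (lshift n j) = 0 by rewrite /w (unsplitK (inl j : 'I_n + 'I_n)%type).
have wr j : w (rshift n j) = v j by rewrite /w (unsplitK (inr j : 'I_n + 'I_n)%type).
have nw : seminorm (@dotn R H (n + n)) w = seminorm (@dotn R H n) v.
  rewrite /seminorm /dotn big_split_ord /= [X in X + _]big1 ?add0r => [|j _].
    by congr (Num.sqrt (Re _)); apply: eq_bigr => j _; rewrite wr.
  by rewrite wl (psd0l hp).
have := act_le cT (corner x) w n2; rewrite nw => h.
apply: le_trans (_ : seminorm (@dotn R H (n + n)) (act T (corner x) w) <= _).
  rewrite -ler_sqr ?nnegrE ?seminorm_ge0 // !(seminorm_form_sum _ hp)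
    big_split_ord /=.
  rewrite -[leLHS]addr0 lerD //; last by apply: sumr_ge0 => i _; exact: sqr_ge0.
  rewrite le_eqVlt; apply/orP; left; apply/eqP; apply: eq_bigr => i _.
  congr (seminorm _ _ ^+ 2); rewrite !act_sum big_split_ord /=.
  rewrite [X in _ = X + _]big1 ?add0r => [|j _]; last by rewrite corner_ul rep_0x.
  by apply: eq_bigr => j _; rewrite corner_ur wr.
by apply: le_trans h _; rewrite -[leRHS]mulr1 ler_wpM2l // opspace_mxnorm_ge0.
Qed.
End Corner.

Theorem theorem1p1 (R : realType) (X : operatorSpace R) (u : X)
    (hu : `|u| <= 1) :
  unital_operator_space u <->
  forall (n : nat) (x : 'M[X]_n), (0 < n)%N ->
    \big[Num.max/0]_(k < 4)
        mxnorm (diag_amp u n + scale_entries ('i%C ^+ k) x)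
      >= Num.sqrt (1 + mxnorm x).
Proof.
split=> [hunital n x n0|pencil]; first exact: unital_pencil_le.
have [W [B [ufB norming]]] := norming_form hu pencil.
have [K [S [Su Sb Sle Sge]]] := unital_compression ufB.
have Siso n (x : 'M[X]_n) : (0 < n)%N -> opnorm (map_mx S x) = mxnorm x.
  move=> n0; apply/eqP; rewrite eq_le Sle //=.
  apply: le_trans (mxnorm_corner x n0) _.
  have n2 : (0 < n + n)%N by rewrite addn_gt0 n0.
  have [xi xi1] := norming _ (corner x) n2.
  have B0 p q : B 0 p q = 0.
    have := form_linx ufB (-1) 0 0 p q.
    by rewrite scaleN1r oppr0 addr0 mulN1r addNr.
  rewrite big_split_ord /= [X in _ + X]big1 ?addr0; last first.
    by move=> k _; apply: big1 => l _; rewrite corner_d B0.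
  under eq_bigr => k _.
    rewrite big_split_ord /= [X in X + _]big1 ?add0r; last first.
      by move=> l _; rewrite corner_ul B0.
    under eq_bigr do rewrite corner_ur.
  over.
  move=> /le_trans /(_ (Sge n x (fun l => xi (rshift n l)) (fun k =>
    xi (lshift n k)) n0)).
  have gp := form_psd ufB.
  have : seminorm (@amp_form R X u W B (n + n)) xi ^+ 2 <= 1.
    by rewrite expr_le1 // seminorm_ge0.
  rewrite (seminorm_form_sum _ gp) big_split_ord /= -!(seminorm_form_sum _ gp).
  rewrite -!/(@amp_form R X u W B n).
  set s1 := seminorm _ _; set s2 := seminorm _ _ => s12.
  have o0 : 0 <= opnorm (map_mx S x) by apply: opnorm_ge0 => i j; rewrite mxE.
  have ss : s2 * s1 <= 1 / 2 by have := sqr_ge0 (s1 - s2); rewrite sqrrB; lra.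
  have := ler_wpM2l o0 ss; lra.
exists K, S; split => //.
apply: contrapT => /forallNP K0.
(* On the zero space every norm would vanish, and so would the left-hand side
   of the inequality at x = 0. *)
have K0' (v : K) : v = 0 by apply/eqP/negPn/negP; exact: K0.
have m0 n (x : 'M[X]_n) : (0 < n)%N -> mxnorm x <= 0.
  move=> n0; rewrite -Siso //; apply: opnorm_le => v _.
  rewrite (_ : mxapply _ v = 0) ?l2normE ?(seminorm0 (@dotn_psd R K n)) //.
  by apply/funext => i; exact: K0'.
have := pencil 1%N 0 isT; apply/negP; rewrite -ltNge.
apply: le_lt_trans (_ : _ <= 0) _.
  by apply: bigmax_le => // k _; exact: m0.
by rewrite sqrtr_gt0 ltr_wpDr // opspace_mxnorm_ge0.
Qed.
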